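(* For every positive integer $k$, there exists an extremal Type~II $\mathbb{Z}_{2k}$-code of length $64$.
   Context: $\mathbb{Z}_m$ denotes the ring of integers modulo $m$. A $\mathbb{Z}_m$-code of length $n$ is a $\mathbb{Z}_m$-submodule of $\mathbb{Z}_m^n$; it is self-dual if $C=C^\perp$ with respect to the standard inner product. The Euclidean weight of $x=(x_1,\dots,x_n)\in\mathbb{Z}_m^n$ is $\sum_{\alpha=1}^{\lfloor m/2\rfloor} n_\alpha(x)\alpha^2$, where $n_\alpha(x)$ is the number of $i$ with $x_i\equiv\pm\alpha \pmod m$; $d_E(C)$ is the minimum Euclidean weight of a nonzero codeword. A Type~II $\mathbb{Z}_{2k}$-code is a self-dual $\mathbb{Z}_{2k}$-code all of whose codewords have Euclidean weight divisible by $4k$. For a Type~II $\mathbb{Z}_{2k}$-code $C$ of length $n\le 136$ one has $d_E(C)\le 4k\lfloor n/24\rfloor+4k$, and $C$ is called extremal if equality holds. *)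

(* Defs.v *)
From HB Require Import structures.
From mathcomp Require Import all_boot all_order all_algebra.
Set Implicit Arguments. Unset Strict Implicit. Unset Printing Implicit Defensive.
Import Order.TTheory GRing.Theory Num.Theory.
Local Open Scope ring_scope.

(* Z_m-codes of length n: subsets of 'rV['Z_m]_n that are Z_m-submodules.
   ('Z_m is the integers modulo m; callers ensure m >= 2.) *)
Definition is_code (m n : nat) (C : {set 'rV['Z_m]_n}) : Prop :=
  [/\ 0 \in C,
      (forall x y, x \in C -> y \in C -> x + y \in C) &
      (forall (a : 'Z_m) x, x \in C -> a *: x \in C)].

Definition dotp (m n : nat) (x y : 'rV['Z_m]_n) : 'Z_m :=
  \sum_(i < n) x ord0 i * y ord0 i.

Definition dual_code (m n : nat) (C : {set 'rV['Z_m]_n}) : {set 'rV['Z_m]_n} :=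
  [set y | [forall x in C, dotp x y == 0]].

Definition self_dual (m n : nat) (C : {set 'rV['Z_m]_n}) : Prop :=
  is_code C /\ C = dual_code C.

Definition n_alpha (m n : nat) (a : nat) (x : 'rV['Z_m]_n) : nat :=
  #|[set i : 'I_n | (x ord0 i == a%:R) || (x ord0 i == - a%:R)]|.

Definition euclid_wt (m n : nat) (x : 'rV['Z_m]_n) : nat :=
  (\sum_(1 <= a < (m %/ 2).+1) n_alpha a x * a ^ 2)%N.

Definition is_min_euclid_wt (m n : nat) (C : {set 'rV['Z_m]_n}) (d : nat) : Prop :=
  (exists2 x, x \in C & x != 0 /\ euclid_wt x = d) /\
  (forall x, x \in C -> x != 0 -> (d <= euclid_wt x)%N).

Definition typeII (k n : nat) (C : {set 'rV['Z_(k.*2)]_n}) : Prop :=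
  self_dual C /\ (forall x, x \in C -> (4 * k %| euclid_wt x)%N).

(* Extremal Type II Z_{2k}-code of length n (n <= 136) *)
Definition extremal_typeII (k n : nat) (C : {set 'rV['Z_(k.*2)]_n}) : Prop :=
  typeII C /\ is_min_euclid_wt C (4 * k * (n %/ 24) + 4 * k)%N.

(* Main.v *)
From HB Require Import structures.
Require Import Defs.
From mathcomp Require Import all_boot all_order all_algebra.
From mathcomp Require Import zify ring lra.

(* If an integral lattice L of dimension 64 is even and unimodular, an orthogonal frame of 64
   vectors of norm 2k in L presents L as Construction A of a Type II Z_2k-code. This code is
   extremal when the vectors of L outside the span of the frame have norm at least 6, with
   equality for some vector. For k >= 3 it suffices to find frames in one lattice of minimum 6;
   for k = 1 and k = 2 the frame vectors are shorter than 6 and explicit codes are used.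

   The lattice is {(p, pK + 6z)} / sqrt 6, with K = 3N - 2M, where M is a skew-hermitian 8x8
   matrix over the Lipschitz quaternions with M^2 = -11 and N is monomial with N N^T = 3. A
   lattice vector reduces modulo 3 into the ternary code (1 | M), and modulo 2 into eight copies
   of the Hamming code, which give eight blocks of type E8. Before division by sqrt 6, each
   block has norm divisible by 4, the blocks of norm 4 are roots, and any four of the eight
   blocks determine the ternary word. A norm below 36 leaves room for at most six nonzero
   blocks, and a finite search over roots excludes them all.

   Multiplications by quaternions X = x1 i + x2 j + x3 k on the other side commute with M, hence
   2 [P, Q; -Q^T, P^T] with P = a + 3X, Q = b M + 3 x4, a = b mod 3, is a frame with
   3k = a^2 + 11 b^2 + 9 (x1^2 + x2^2 + x3^2 + x4^2). By the four squares theorem (a, b) = (0, 0),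
   (1, 1) and (-2, 1) give all k >= 3.

   For k = 1 the code is a bordered back-circulant self-dual [64, 32, 12] code. For k = 2 it is a
   Z_4-code whose residue code is an extended BCH code [64, 13, 24] with dual distance 6. *)

Set Implicit Arguments. Unset Strict Implicit. Unset Printing Implicit Defensive.
Import Order.TTheory GRing.Theory Num.Theory.
Local Open Scope ring_scope.

(** * Integral inner products and reduction modulo [2k] *)

Lemma Zp_intr_eq0 (m : nat) (z : int) : (1 < m)%N -> (z%:~R == 0 :> 'Z_m) = (m %| z)%Z.
Proof.
move=> m_gt1.
have nat0 (n : nat) : (n%:R == 0 :> 'Z_m) = (m %| n)%N.
  by rewrite -val_eqE /= val_Zp_nat.
case: z => n; first by rewrite -pmulrn nat0.
by rewrite NegzE rmorphN /= oppr_eq0 -pmulrn nat0.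
Qed.

Definition ip (n : nat) (u v : 'rV[int]_n) : int := \sum_i u 0 i * v 0 i.

Section InnerProduct.
Variable n : nat.
Implicit Types u v w : 'rV[int]_n.

Lemma ipE u v : ip u v = (u *m v^T) 0 0.
Proof. by rewrite mxE; apply: eq_bigr => i _; rewrite mxE. Qed.

Lemma ipC u v : ip u v = ip v u.
Proof. by apply: eq_bigr => i _; rewrite mulrC. Qed.

Lemma ipZl a u v : ip (a *: u) v = a * ip u v.
Proof. by rewrite !ipE -scalemxAl mxE. Qed.

Lemma ipZr a u v : ip u (a *: v) = a * ip u v.
Proof. by rewrite ipC ipZl ipC. Qed.

Lemma ipDl u v w : ip (u + v) w = ip u w + ip v w.
Proof. by rewrite !ipE mulmxDl mxE. Qed.

Lemma ipDr u v w : ip u (v + w) = ip u v + ip u w.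
Proof. by rewrite ipC ipDl !(ipC u). Qed.

Lemma ip_row p (A : 'M_(p, n)) u i : (u *m A^T) 0 i = ip u (row i A).
Proof. by rewrite mxE; apply: eq_bigr => j _; rewrite !mxE. Qed.

Lemma ip_delta u i : ip u (delta_mx 0 i) = u 0 i.
Proof. by rewrite ipE trmx_delta -colE mxE. Qed.

Lemma ip_eq0 u : ip u u = 0 -> u = 0.
Proof.
move=> /eqP; rewrite psumr_eq0 => [|i _]; last by rewrite -expr2 sqr_ge0.
move=> /allP u0; apply/rowP=> i; have := u0 i; rewrite mem_index_enum mxE => /(_ isT).
by rewrite /= mulf_eq0 orbb => /eqP.
Qed.

End InnerProduct.

Lemma ip_mulmx n p (u : 'rV[int]_n) (A : 'M_(n, p)) (w : 'rV_p) :
  ip (u *m A) w = ip u (w *m A^T).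
Proof. by rewrite !ipE trmx_mul trmxK mulmxA. Qed.

Section ModularReduction.
Variables (k n : nat).
Hypothesis k_gt0 : (0 < k)%N.

Let m_gt1 : (1 < k.*2)%N. Proof. by lia. Qed.

Definition redmx (y : 'rV[int]_n) : 'rV['Z_(k.*2)]_n := map_mx intr y.

(** The representative of least absolute value, in the interval from [-k + 1] to [k]; the class of
    [k] is lifted to [+k]. *)
Definition centered_lift (a : 'Z_(k.*2)) : int :=
  if (a <= k)%N then a%:Z else a%:Z - k.*2%:Z.

Definition liftmx (x : 'rV['Z_(k.*2)]_n) : 'rV[int]_n := map_mx centered_lift x.

Let val_lt (a : 'Z_(k.*2)) : (a < k.*2)%N.
Proof. by rewrite -[X in (_ < X)%N](Zp_cast m_gt1). Qed.

Lemma intr_centered_lift a : (centered_lift a)%:~R = a.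
Proof.
rewrite /centered_lift; case: ifP => _; rewrite ?rmorphB /= -!pmulrn natr_Zp //.
by rewrite pchar_Zp // subr0.
Qed.

Lemma liftmxK : cancel liftmx redmx.
Proof. by move=> x; apply/rowP => i; rewrite !mxE intr_centered_lift. Qed.

Lemma redmx_eq0 y : (redmx y = 0) <-> exists z, y = k.*2%:Z *: z.
Proof.
split=> [y0 | [z ->]]; last first.
  by apply/rowP => i; rewrite !mxE rmorphM /= -pmulrn pchar_Zp // mul0r.
exists (map_mx (divz^~ k.*2%:Z) y); apply/rowP => i; rewrite !mxE.
move/rowP/(_ i): y0; rewrite !mxE => /eqP; rewrite Zp_intr_eq0 // => /divzK.
by rewrite mulrC => ->.
Qed.

Lemma dotp_redmx u v : (dotp (redmx u) (redmx v) == 0) = (k.*2 %| ip u v)%Z.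
Proof.
rewrite -Zp_intr_eq0 // rmorph_sum /=; congr (_ == _).
by apply: eq_bigr => i _; rewrite !mxE rmorphM.
Qed.

Lemma centered_lift_range a : - k%:Z <= centered_lift a <= k%:Z.
Proof. by have := val_lt a; rewrite /centered_lift; move: (nat_of_ord a) => c; case: ifP; lia. Qed.

(** With [z = c + 2kq] and [|c| <= k], the difference of squares is [4k] times [q (c + kq)], which
    is nonnegative because [kq] dominates [c] unless [q = 0]. *)
Lemma centered_lift_le (z : int) : centered_lift z%:~R ^+ 2 <= z ^+ 2.
Proof.
have : (k.*2 %| z - centered_lift z%:~R)%Z.
  by rewrite -Zp_intr_eq0 // rmorphB /= intr_centered_lift subrr.
have := centered_lift_range z%:~R; move: (centered_lift _) => c c_range /dvdzP[q zE].
have {zE} -> : z = c + q * (2 * k%:Z) by lia.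
have q_ge0 : 0 <= q * (c + k%:Z * q) by have [] := ltrgt0P q; nia.
have -> : (c + q * (2 * k%:Z)) ^+ 2 = c ^+ 2 + 4 * k%:Z * (q * (c + k%:Z * q)) by ring.
by rewrite lerDl mulr_ge0.
Qed.

(** For [1 <= a <= k] a coordinate is [a] or [-a] modulo [2k] exactly when its centered lift has
    absolute value [a]. Exchanging the sums over [a] and over the coordinates then gives a sum of
    squares. *)
Lemma euclid_wtE x : (euclid_wt x)%:Z = ip (liftmx x) (liftmx x).
Proof.
have pm_eq (b : 'Z_(k.*2)) (a : nat) : (1 <= a < k.+1)%N ->
    (b == a%:R) || (b == - a%:R) = (`|centered_lift b| == a)%N.
  move=> a_range; rewrite -subr_eq0 -[_ == - _]subr_eq0 opprK.
  rewrite -{1 2}(intr_centered_lift b) pmulrn -rmorphB -rmorphD /= !Zp_intr_eq0 //.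
  have := centered_lift_range b; move: (centered_lift b) => c c_range.
  have small (q : int) : - (2 * k)%:Z <= q * k.*2%:Z <= (2 * k)%:Z -> q = 0 \/ q = 1 \/ q = -1.
    move=> q_bound; have [q_gt1|q_le1] := ltrP 1 q; first nia.
    have [q_lt1|q_ge1] := ltrP q (-1); first nia.
    lia.
  apply/orP/eqP => [[/dvdzP[q hq]|/dvdzP[q hq]]|h].
  - have := small q; rewrite -hq => /(_ ltac:(lia)) [|[]] q_val; subst q; lia.
  - have := small q; rewrite -hq => /(_ ltac:(lia)) [|[]] q_val; subst q; lia.
  have [c_ge0|c_lt0] := lerP 0 c.
    by left; apply/dvdzP; exists 0; lia.
  by right; apply/dvdzP; exists 0; lia.
have half_m : (k.*2 %/ 2 = k)%N by rewrite -muln2 mulnK.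
rewrite /euclid_wt /n_alpha half_m.
transitivity (\sum_(i < n) (`|liftmx x ord0 i| ^ 2)%N%:Z); last first.
  by apply: eq_bigr => i _; move: (liftmx _ _ _) => z; rewrite -mulnn; nia.
rewrite -(big_morph Posz PoszD (erefl 0%:Z)); congr Posz.
transitivity (\sum_(1 <= a < k.+1) \sum_(i < n) ((`|liftmx x ord0 i| == a) * a ^ 2))%N.
  apply: eq_big_nat => a a_range; rewrite -sum1dep_card big_distrl /= big_mkcond.
  by apply: eq_bigr => i _; rewrite pm_eq // mxE; case: eqP; rewrite ?mul1n.
rewrite exchange_big; apply: eq_bigr => i _ /=.
have c_le : (`|liftmx x ord0 i| <= k)%N.
  by rewrite mxE; have := centered_lift_range (x ord0 i); move: (centered_lift _) => z; lia.
have [c0 | c_neq0] := eqVneq `|liftmx x ord0 i|%N 0%N.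
  by rewrite c0 big1_seq // => a; rewrite mem_index_iota; case: eqP => // <-.
rewrite (bigD1_seq `|liftmx x ord0 i|%N) ?iota_uniq ?mem_index_iota /=; try lia.
by rewrite eqxx mul1n big1 ?addn0 // => a; rewrite eq_sym => /negPf ->.
Qed.
End ModularReduction.

(** * Codes from frames of a lattice *)

Lemma scalemx_intI (m n : nat) (a : int) : a != 0 -> injective ( *:%R a : 'M[int]_(m, n) -> _).
Proof.
by move=> a0 A B AB; apply/matrixP => i j; move/matrixP/(_ i j): AB; rewrite !mxE => /(mulfI a0).
Qed.

Section FrameCode.
Variables (k m : nat) (L : pred 'rV[int]_64) (T : 'M[int]_64).
Hypothesis k_gt0 : (0 < k)%N.
Hypothesis m_gt0 : (0 < m)%N.
(** The lattice meant is [L / sqrt m]: this condition says that it is unimodular, the next one that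
    it is even. The rows of [T] are then an orthogonal frame of norm [2k], and norm 6 becomes
    [6m]. *)
Hypothesis L_dual : forall v, L v <-> forall w, L w -> (m %| ip v w)%Z.
Hypothesis L_even : forall v, L v -> ((2 * m)%N %| ip v v)%Z.
Hypothesis T_row : forall i, L (row i T).
Hypothesis T_frame : T *m T^T = ((2 * k * m)%:Z)%:M.
Hypothesis L_min : forall v, L v -> ip v v < (6 * m)%:Z -> exists y, v = y *m T.
Hypothesis L_short : exists v, [/\ L v, ip v v = (6 * m)%:Z & forall y, v <> y *m T].

(** Over the rationals a one-sided inverse of a square matrix is two-sided. *)
Let frame' : T^T *m T = ((2 * k * m)%:Z)%:M.
Proof.
pose c : rat := (2 * k * m)%:Q.
have c_neq0 : c != 0 by rewrite intr_eq0; lia.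
have : (c^-1 *: map_mx intr T) *m map_mx intr T^T = 1%:M :> 'M[rat]_64.
  by rewrite -scalemxAl -map_mxM T_frame map_scalar_mx scale_scalar_mx mulVf.
move/mulmx1C; rewrite -scalemxAr -map_mxM => /(congr1 ( *:%R c)).
rewrite scalerA mulfV // scale1r scale_scalar_mx mulr1 => TT.
apply/matrixP => i j; move/matrixP/(_ i j): TT; rewrite !mxE => /eqP.
by rewrite -[c *+ _](rmorphMn (intr : int -> rat)) eqr_int => /eqP.
Qed.

(** Here [y / 2k] lists the coordinates of [v] in the frame. The boolean form that follows is needed
    to define the code as a finite set. *)
Let inL y := exists2 v, L v & y *m T = k.*2%:Z *: v.

Let inLb (y : 'rV[int]_64) : bool :=
  [forall j, k.*2 %| (y *m T) ord0 j]%Z && L (map_mx (divz^~ k.*2%:Z) (y *m T)).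

Let k2_neq0 : k.*2%:Z != 0. Proof. by lia. Qed.

Let inLP y : reflect (inL y) (inLb y).
Proof.
apply: (iffP andP) => [[/forallP dvd_yT Lv]|[v Lv yT]].
  exists (map_mx (divz^~ k.*2%:Z) (y *m T)) => //.
  by apply/rowP => j; rewrite !mxE mulrC divzK //; have := dvd_yT j; rewrite mxE.
split; first by apply/forallP => j; rewrite yT mxE dvdz_mulr.
suff -> : map_mx (divz^~ k.*2%:Z) (y *m T) = v by [].
by apply/rowP => j; rewrite yT !mxE mulKz.
Qed.

Let L0 : L 0.
Proof. by apply/L_dual => w _; rewrite ipE mul0mx mxE dvdz0. Qed.

Let LD v w : L v -> L w -> L (v + w).
Proof.
move=> /L_dual Lv /L_dual Lw; apply/L_dual => u Lu.
by rewrite ipDl rpredD ?Lv ?Lw.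
Qed.

Let LZ a v : L v -> L (a *: v).
Proof. by move=> /L_dual Lv; apply/L_dual => u Lu; rewrite ipZl dvdz_mull // Lv. Qed.

Let LmulT z : L (z *m T).
Proof.
rewrite mulmx_sum_row; apply: (big_ind L) => [|v w|i _]; first exact: L0.
  exact: LD.
by apply: LZ; apply: T_row.
Qed.

Let LmZ v : L (m%:Z *: v).
Proof. by apply/L_dual => u _; rewrite ipZl dvdz_mulr. Qed.

Let inL_red y y' : redmx k y = redmx k y' -> inL y -> inL y'.
Proof.
move=> yy' [v Lv yT].
have /redmx_eq0 [] // : redmx k (y' - y) = 0.
  by rewrite /redmx map_mxB; apply/eqP; rewrite subr_eq0; apply/eqP/esym.
move=> z /eqP; rewrite subr_eq => /eqP ->; exists (z *m T + v); first exact: LD.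
by rewrite mulmxDl -scalemxAl yT scalerDr.
Qed.

Let inL_ip x y v w : x *m T = k.*2%:Z *: v -> y *m T = k.*2%:Z *: w ->
  m%:Z * ip x y = k.*2%:Z * ip v w.
Proof.
move=> xT yT.
have : ip (x *m T) (y *m T) = (2 * k * m)%:Z * ip x y.
  by rewrite ip_mulmx -mulmxA T_frame mul_mx_scalar ipZr.
rewrite xT yT ipZl ipZr => e; apply: (mulfI k2_neq0); rewrite e.
by rewrite -muln2 mulnC PoszM mulrA.
Qed.

(** The coordinates [v T^T / m] are integral because the rows of [T] lie in [L]. *)
Let inL_coord v : L v -> exists2 x, x *m T = k.*2%:Z *: v & m%:Z *: x = v *m T^T.
Proof.
move=> Lv; have mx_eq : m%:Z *: map_mx (divz^~ m%:Z) (v *m T^T) = v *m T^T.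
  apply/rowP => j; rewrite mxE [in LHS]mxE mulrC divzK // ip_row.
  by move/L_dual: Lv; apply.
exists (map_mx (divz^~ m%:Z) (v *m T^T)) => //.
have m_neq0 : m%:Z != 0 by lia.
apply: (scalemx_intI m_neq0).
rewrite scalemxAl mx_eq -mulmxA frame' mul_mx_scalar scalerA.
by congr (_ *: _); lia.
Qed.

Let C : {set 'rV['Z_(k.*2)]_64} := [set x | inLb (liftmx x)].

Let memC y : reflect (inL y) (redmx k y \in C).
Proof.
rewrite inE; apply: (iffP (inLP _)); apply: inL_red; rewrite liftmxK //.
Qed.

Let C_red x : x \in C -> exists y, [/\ x = redmx k y, inL y & ip y y = (euclid_wt x)%:Z].
Proof.
rewrite inE => /inLP yL; exists (liftmx x); split=> //; first by rewrite liftmxK.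
by rewrite euclid_wtE.
Qed.

Let euclid_wt_red (y : 'rV[int]_64) : (euclid_wt (redmx k y))%:Z <= ip y y.
Proof.
rewrite euclid_wtE //; apply: ler_sum => i _; rewrite !mxE -!expr2.
exact: centered_lift_le.
Qed.

Let C_code : is_code C.
Proof.
split.
- have -> : 0 = redmx k 0 :> 'rV['Z_(k.*2)]_64 by rewrite /redmx map_mx0.
  by apply/memC; exists 0; rewrite ?mul0mx ?scaler0.
- move=> _ _ /C_red[x [-> [v Lv xT] _]] /C_red[y [-> [w Lw yT] _]].
  rewrite /redmx -map_mxD; apply/memC; exists (v + w); first exact: LD.
  by rewrite mulmxDl xT yT scalerDr.
move=> a _ /C_red[x [-> [v Lv xT] _]].
have -> : a *: redmx k x = redmx k (centered_lift a *: x).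
  by apply/rowP => i; rewrite !mxE rmorphM /= intr_centered_lift.
by apply/memC; exists (centered_lift a *: v); rewrite ?LZ // -scalemxAl xT !scalerA mulrC.
Qed.

(** If [y] is orthogonal to the code modulo [2k], then [2km] divides the inner product of [yT] with
    every vector of [L]. The vectors [m e_j] lie in [L], so [w = yT / 2k] is integral, and
    unimodularity puts [w] in [L]. *)
Let C_self_dual : self_dual C.
Proof.
split=> //; apply/setP => y'; rewrite [RHS]inE.
apply/idP/forall_inP => [/C_red[y [-> [w Lw yT] _]] x' /C_red[x [-> [v Lv xT] _]]|].
  rewrite dotp_redmx // -(@dvdz_mul2l m%:Z); last by lia.
  by rewrite (inL_ip xT yT) mulrC dvdz_mul //; move/L_dual: Lv; apply.
rewrite -(liftmxK k_gt0 y'); set y := liftmx y' => orth.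
have dvd_yT v : L v -> (k.*2%:Z * m%:Z %| ip v (y *m T))%Z.
  move=> Lv; have [x xT mx] := inL_coord Lv.
  have /orth : redmx k x \in C by apply/memC; exists v.
  rewrite dotp_redmx // => dvd_xy.
  rewrite -[y]trmxK -[T]trmxK -ip_mulmx ?trmxK -mx ipZl mulrC dvdz_mul //.
have dvd_yTj j : (k.*2 %| (y *m T) ord0 j)%Z.
  have := dvd_yT (m%:Z *: delta_mx 0 j) (LmZ _).
  by rewrite ipZl ipC ip_delta mulrC dvdz_mul2r; lia.
pose w := map_mx (divz^~ k.*2%:Z) (y *m T).
have yT : y *m T = k.*2%:Z *: w.
  by apply/rowP => j; rewrite !mxE mulrC divzK //; have := dvd_yTj j; rewrite mxE.
apply/memC; exists w => //; apply/L_dual => v /dvd_yT.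
by rewrite yT ipZr dvdz_mul2l 1?ipC; lia.
Qed.

Let C_norm x : x \in C -> exists2 v, L v &
  m%:Z * (euclid_wt x)%:Z = k.*2%:Z * ip v v /\ (x != 0 -> forall y, v <> y *m T).
Proof.
case/C_red => y [-> [v Lv yT] <-]; exists v => //; split; first exact: (inL_ip yT yT).
move=> y_neq0 z v_eq; case/negP: y_neq0; apply/eqP/redmx_eq0 => //; exists z.
move: yT; rewrite v_eq scalemxAl => /(congr1 (mulmx^~ T^T)).
rewrite -!mulmxA T_frame !mul_mx_scalar; apply: scalemx_intI; lia.
Qed.

(** A codeword of Euclidean weight [e] comes from some [v] in [L] with [m e = 2k (v, v)], and [v] is
    outside the span of the frame when the codeword is nonzero. Hence norm [6m] corresponds to
    weight [12k], and divisibility of norms by [2m] to divisibility of weights by [4k]. *)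
Theorem frame_code : exists C' : {set 'rV['Z_(k.*2)]_64}, extremal_typeII C'.
Proof.
have lower x : x \in C -> x != 0 -> (12 * k <= euclid_wt x)%N.
  case/C_norm => v Lv [wtE v_neq] x_neq0.
  have v_ge : (6 * m)%:Z <= ip v v.
    by rewrite leNgt; apply/negP => /(L_min Lv)[y]; apply: v_neq.
  rewrite -lez_nat -(@ler_pM2l _ m%:Z) ?ltz_nat // wtE.
  apply: le_trans (_ : k.*2%:Z * (6 * m)%:Z <= _); first lia.
  by rewrite ler_pM2l // ltz_nat double_gt0.
have dist : (4 * k * (64 %/ 24) + 4 * k = 12 * k)%N by have -> : (64 %/ 24 = 2)%N by []; lia.
exists C; split; first split=> //.
  move=> x /C_norm[v /L_even/dvdzP[q qE] [wtE _]].
  have wt_q : m%:Z * (euclid_wt x)%:Z = m%:Z * (q * (4 * k)%:Z).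
    by rewrite wtE qE -muln2 !PoszM; ring.
  suff : ((4 * k)%:Z %| (euclid_wt x)%:Z)%Z by [].
  by apply/dvdzP; exists q; apply: mulfI wt_q; lia.
rewrite dist; split=> //.
have [v [Lv v_norm v_neq]] := L_short; have [x xT mx] := inL_coord Lv.
have xC : redmx k x \in C by apply/memC; exists v.
have x_neq0 : redmx k x != 0.
  apply/eqP => /redmx_eq0[] // y x_eq; apply: (v_neq y).
  by apply: (scalemx_intI k2_neq0); rewrite -xT x_eq -scalemxAl.
exists (redmx k x) => //; split=> //; apply/eqP; rewrite eqn_leq lower // andbT.
(* The coordinates [x] of the short vector have norm [12k]. Centering them modulo [2k] can only
   lower the norm, and [lower] excludes a smaller weight. *)
have := euclid_wt_red x; have := inL_ip xT xT; rewrite v_norm; nia.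
Qed.

End FrameCode.

(** * Lattices generated by [(1 | K)] and [(0 | m)] *)

Lemma ip_row_mx n p (u u' : 'rV[int]_n) (v v' : 'rV[int]_p) :
  ip (row_mx u v) (row_mx u' v') = ip u u' + ip v v'.
Proof. by rewrite !ipE tr_row_mx mul_row_col mxE. Qed.

Lemma dvd_mxP m n (y : 'rV[int]_n) :
  reflect (exists z, y = m%:Z *: z) [forall j, (m %| y ord0 j)%Z].
Proof.
apply: (iffP forallP) => [dvd_y|[z -> j]]; last by rewrite mxE dvdz_mulr.
exists (map_mx (divz^~ m%:Z) y); apply/rowP => j; rewrite !mxE mulrC divzK //.
Qed.

Section Systematic.
Variables (n m : nat) (K S S' : 'M[int]_n).
Hypothesis m_even : ~~ odd m.
Hypothesis KKT : 1%:M + K *m K^T = m%:Z *: (S + S^T).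
Hypothesis KTK : 1%:M + K^T *m K = m%:Z *: S'.

Definition syslat (v : 'rV[int]_(n + n)) :=
  [forall j, (m %| (rsubmx v - lsubmx v *m K) ord0 j)%Z].

Lemma syslatP v :
  reflect (exists z, v = row_mx (lsubmx v) (lsubmx v *m K + m%:Z *: z)) (syslat v).
Proof.
apply: (iffP (dvd_mxP _ _)) => [[z zE]|[z zE]]; exists z.
  by rewrite -zE addrC subrK hsubmxK.
by rewrite zE row_mxKr row_mxKl addrC addKr.
Qed.

Lemma syslat_row p z : syslat (row_mx p (p *m K + m%:Z *: z)).
Proof. by apply/syslatP; exists z; rewrite !row_mxKl. Qed.

Lemma ip_syslat p z p' z' :
  ip (row_mx p (p *m K + m%:Z *: z)) (row_mx p' (p' *m K + m%:Z *: z')) =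
  m%:Z * (ip p (p' *m (S + S^T)) + ip (p *m K) z' + ip z (p' *m K) + m%:Z * ip z z').
Proof.
rewrite ip_row_mx ipDl !ipDr !ipZl !ipZr ip_mulmx.
have -> : p' *m K *m K^T = m%:Z *: (p' *m (S + S^T)) - p'.
  by rewrite scalemxAr -KKT mulmxDr mulmx1 mulmxA addrC addKr.
by rewrite -scaleN1r ipDr !ipZr; ring.
Qed.

(** For [v = (a, b)], testing against [(e_j, e_j K)] gives [a + b K^T = m y]. Then
    [1 + K^T K = m S'] turns [b - a K] into [m (b S' - y K)]. *)
Lemma syslat_dual v : syslat v <-> forall w, syslat w -> (m %| ip v w)%Z.
Proof.
split=> [/syslatP[z ->] w /syslatP[z' ->]|v_orth].
  by rewrite ip_syslat dvdz_mulr.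
have /dvd_mxP[y yE] : [forall j, (m %| (lsubmx v + rsubmx v *m K^T) ord0 j)%Z].
  apply/forallP => j.
  have := v_orth _ (syslat_row (delta_mx 0 j) 0).
  by rewrite scaler0 addr0 -{1}[v]hsubmxK ip_row_mx [ip (rsubmx v) _]ipC ip_mulmx
    (ipC (delta_mx _ _)) -!ipDl ip_delta.
apply/dvd_mxP; exists (rsubmx v *m S' - y *m K).
have -> : lsubmx v = m%:Z *: y - rsubmx v *m K^T by rewrite -yE addrK.
rewrite mulmxBl -mulmxA -scalemxAl.
have -> : K^T *m K = m%:Z *: S' - 1%:M by rewrite -KTK addrC addKr.
rewrite mulmxBr mulmx1 -scalemxAr scalerBr.
by rewrite opprB addrA [rsubmx v + _]addrC subrK.
Qed.

(** Apart from the term [m (z, z)], which is even because [m] is, all terms in the norm divided by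
    [m] occur in equal pairs; for the Gram part this is the reason for writing it as [S + S^T]. *)
Lemma syslat_even v : syslat v -> ((2 * m)%N %| ip v v)%Z.
Proof.
case/syslatP=> z ->; set p := lsubmx v; rewrite ip_syslat mulmxDr ipDr.
have -> : ip p (p *m S^T) = ip p (p *m S) by rewrite -ip_mulmx ipC.
rewrite (ipC z); have [q ->] : exists q, m = q.*2 by exists m./2; lia.
apply/dvdzP; exists (ip p (p *m S) + ip (p *m K) z + q%:Z * ip z z).
by rewrite -!muln2 !PoszM; ring.
Qed.

End Systematic.

(** * The ternary code *)

Local Close Scope ring_scope.

(** The field with three elements: [None] is 0, [Some false] is 1 and [Some true] is 2, so that
    arithmetic is plain pattern matching. *)
Notation trit := (option bool).
Definition trit0 : trit := None.
Definition trit1 : trit := Some false.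
Definition trit2 : trit := Some true.
Definition trit_add (a b : trit) : trit :=
  match a, b with
  | None, _ => b
  | _, None => a
  | Some false, Some false => trit2
  | Some true, Some true => trit1
  | _, _ => trit0
  end.
Definition trit_opp (a : trit) : trit :=
  match a with None => trit0 | Some false => trit2 | Some true => trit1 end.
Definition trit_mul (a b : trit) : trit :=
  match a with None => trit0 | Some false => b | Some true => trit_opp b end.
Definition trit_of_int (z : int) : trit :=
  match z with
  | Posz n => match n %% 3 with 0 => trit0 | 1 => trit1 | _ => trit2 end
  | Negz n => match n %% 3 with 0 => trit2 | 1 => trit1 | _ => trit0 end
  end.
Fixpoint map2 (A : Type) (f : A -> A -> A) (s t : seq A) : seq A :=
  match s, t with x :: s', y :: t' => f x y :: map2 f s' t' | _, _ => [::] end.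
Definition tvec_add := map2 trit_add.
Definition tvec_scale (a : trit) (v : seq trit) := map (trit_mul a) v.
Fixpoint tvec_dot (s t : seq trit) : trit :=
  match s, t with x :: s', y :: t' => trit_add (trit_mul x y) (tvec_dot s' t') | _, _ => trit0 end.

Definition M_coef_j : seq (seq int) :=
  [:: [:: 1; 1; 0; -1; 0; 0; 0; 0]; [:: 1; 1; 1; 0; 0; 0; 0; 0];
      [:: 0; 1; 1; 1; 0; 0; 0; 0]; [:: -1; 0; 1; 1; 0; 0; 0; 0];
      [:: 0; 0; 0; 0; 1; 1; 0; -1]; [:: 0; 0; 0; 0; 1; 1; 1; 0];
      [:: 0; 0; 0; 0; 0; 1; 1; 1]; [:: 0; 0; 0; 0; -1; 0; 1; 1]]%Z.
Definition M_coef_k : seq (seq int) :=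
  [:: [:: 0; 0; 0; 0; -1; 1; -1; 1]; [:: 0; 0; 0; 0; -1; -1; 1; -1];
      [:: 0; 0; 0; 0; 1; -1; -1; 1]; [:: 0; 0; 0; 0; -1; 1; -1; -1];
      [:: -1; -1; 1; -1; 0; 0; 0; 0]; [:: 1; -1; -1; 1; 0; 0; 0; 0];
      [:: -1; 1; -1; -1; 0; 0; 0; 0]; [:: 1; -1; 1; -1; 0; 0; 0; 0]]%Z.
Definition get (l : seq (seq int)) i j : int := nth 0%R (nth [::] l i) j.
(* The [t]-th coordinate of [e_s q], where [e_0, .., e_3 = 1, i, j, k]. *)
Definition quat_entry (q : seq int) (s t : nat) : int :=
  let c n := nth (0%R : int) q n in
  match s, t with
  | 0, t => c t
  | 1, 0 => (- c 1)%R | 1, 1 => c 0 | 1, 2 => (- c 3)%R | 1, _ => c 2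
  | 2, 0 => (- c 2)%R | 2, 1 => c 3 | 2, 2 => c 0 | 2, _ => (- c 1)%R
  | _, 0 => (- c 3)%R | _, 1 => (- c 2)%R | _, 2 => c 1 | _, _ => c 0
  end.
Definition M_quat a b : seq int :=
  [:: 0%Z; if a == b then 2%Z else 0%Z; get M_coef_j a b; get M_coef_k a b].
Definition M_entry i j := quat_entry (M_quat (i %/ 4) (j %/ 4)) (i %% 4) (j %% 4).

(* Block [b] joins the [b]-th quaternion coordinate of the left half to the one of index
   [block_partner b] of the right half. With this pairing any four of the eight blocks form
   an information set of the ternary code. *)
Definition block_partner := [:: 3; 0; 1; 2; 7; 4; 5; 6].
Definition block_idx b i := if i < 4 then 4 * b + i else 32 + 4 * nth 0 block_partner b + (i - 4).
(* Row [i] of the matrix [(1 | f)]. *)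
Definition id_row (f : nat -> nat -> int) i c : int :=
  if c < 32 then (if c == i then 1%Z else 0%Z) else f i (c - 32).
Definition code_gens := Eval vm_compute in
  [seq [seq [seq trit_of_int (id_row M_entry i (block_idx b c)) | c <- iota 0 8] | b <- iota 0 8]
  | i <- iota 0 32].

Definition word := seq (seq trit).
Definition word_add : word -> word -> word := map2 tvec_add.
Definition word_scale a : word -> word := map (tvec_scale a).
Definition word_dot (x y : word) : trit :=
  foldr (fun b => trit_add (tvec_dot (nth [::] x b) (nth [::] y b))) trit0 (iota 0 8).
Definition word_get (r : word) b i := nth trit0 (nth [::] r b) i.
Definition word0 : word := nseq 8 (nseq 8 trit0).
Fixpoint word_comb (p : seq trit) (g : seq word) : word :=
  match p, g with
  | a :: p', r :: g' =>
    if a is None then word_comb p' g' else word_add (word_scale a r) (word_comb p' g')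
  | _, _ => word0
  end.

(** A nonzero trit is its own inverse, so scaling a row by its pivot entry makes this entry 1. *)
Fixpoint pick_pivot (b i : nat) (acc todo : seq word) : option (word * seq word) :=
  match todo with
  | [::] => None
  | r :: todo' =>
    if word_get r b i is None then pick_pivot b i (r :: acc) todo'
    else Some (word_scale (word_get r b i) r, catrev acc todo')
  end.
(** Gauss-Jordan elimination with the given pivot columns. Only its output matters: [systematic_ok]
    certifies that afterwards. *)
Fixpoint gauss (cols : seq (nat * nat)) (dn todo : seq word) : seq word :=
  match cols with
  | [::] => dn
  | c :: cols' => match pick_pivot c.1 c.2 [::] todo with
    | None => [::]
    | Some (r, todo') =>
      let cl := map (fun x => if word_get x c.1 c.2 is None then x
                              else word_add x (word_scale (trit_opp (word_get x c.1 c.2)) r)) in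
      gauss cols' (rcons (cl dn) r) (cl todo')
    end
  end.
Fixpoint sublists (k : nat) (l : seq nat) : seq (seq nat) :=
  match k, l with
  | 0, _ => [:: [::]]
  | _, [::] => [::]
  | k'.+1, x :: l' => [seq x :: s | s <- sublists k' l'] ++ sublists k l'
  end.
Definition systematic_rows (Q : seq nat) := gauss [seq (b, i) | b <- Q, i <- iota 0 8] [::] code_gens.
(** The entries in the left half. As [(1 | M)] is the identity there, they are the coefficients of a
    codeword in the generators. *)
Definition info_part (r : word) := [seq word_get r (c %/ 4) (c %% 4) | c <- iota 0 32].

(** For each set [Q] of four blocks, generators that form the identity on the 32 coordinates of [Q],
    in four groups of eight, one group for each block of [Q]. *)
Definition systematic_gens : seq (seq nat * seq (seq word)) := Eval vm_compute in
  [seq (Q, reshape (nseq 4 8) (systematic_rows Q)) | Q <- sublists 4 (iota 0 8)].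
Definition unit8 i := [seq (if c == i then trit1 else trit0) | c <- iota 0 8].
Definition zero8 := nseq 8 trit0.
Definition systematic_ok (c : seq nat * seq (seq word)) :=
  [&& size c.2 == 4, all (fun g => size g == 8) c.2 &
   all (fun j => all (fun i => let r := nth [::] (nth [::] c.2 j) i in
     (word_comb (info_part r) code_gens == r) &&
     all (fun j' => nth [::] r (nth 0 c.1 j') == if j' == j then unit8 i else zero8) (iota 0 4))
     (iota 0 8)) (iota 0 4)].
Lemma systematic_gens_ok : all systematic_ok systematic_gens.
Proof. by vm_compute. Qed.

(** * The E8 blocks and the search for short words *)

Definition N_quat (b : nat) : seq int :=
  if (b == 0) || (b == 2) then [:: 1; 1; 1; 0]%Z else [:: 0; 1; 1; 1]%Z.
Definition N_entry i j : int :=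
  if j %/ 4 == nth 0 block_partner (i %/ 4) then quat_entry (N_quat (i %/ 4)) (i %% 4) (j %% 4) else 0%R.
(* The integer operations are named here and below because unfolding the ring structure of
   [int] dominates the running time of the computations. *)
Definition nat_isum (n : nat) (F : nat -> int) : int :=
  foldr (fun c acc => intZmod.addz (F c) acc) 0%Z (iota 0 n).
(** The generators of the Hamming code of each block, taken from the rows of [(1 | N)] modulo 2.
    They serve as parity checks since this code is self-dual. *)
Definition parity_table : seq (seq (seq bool)) := Eval vm_compute in
  [seq [seq [seq odd (absz (id_row N_entry (4 * b + s) (block_idx b c))) | c <- iota 0 8]
       | s <- iota 0 4] | b <- iota 0 8].
Definition bit_dot (h e : seq bool) := foldr (fun p => addb (p.1 && p.2)) false (zip h e).
Definition bits_even_parity b e := all (fun h => ~~ bit_dot h e) (nth [::] parity_table b).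
Definition even_parity b (x : seq int) := bits_even_parity b [seq odd (absz z) | z <- x].
(** Entries of absolute value at most 2 suffice for [q <= 4], the only range used. *)
Fixpoint vectors_of_norm (n q : nat) : seq (seq int) :=
  match n with
  | 0 => if q == 0 then [:: [::]] else [::]
  | n'.+1 => flatten [seq [seq x :: s | s <- vectors_of_norm n' (q - absz x ^ 2)]
                     | x <- [:: 0; 1; -1; 2; -2]%Z & absz x ^ 2 <= q]
  end.
(** Residues modulo 3 of the 240 minimal vectors of [sqrt 2 E8]. Two tables are enough because
    [N_quat] takes only two values. *)
Definition e8roots b : seq (seq trit) := Eval vm_compute in
  let r0 := [seq map trit_of_int x | x <- vectors_of_norm 8 4 & even_parity 0 x] in
  let r1 := [seq map trit_of_int x | x <- vectors_of_norm 8 4 & even_parity 1 x] in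
  if (b == 0) || (b == 2) then r0 else r1.

(* Only the supports of the roots are recorded: the test accepts some non-roots, but never
   rejects a root. *)
Inductive trie := Empty | Accept | Node of trie & trie.
Fixpoint trie_path (v : seq trit) : trie :=
  match v with
  | [::] => Accept
  | None :: v' => Node (trie_path v') Empty
  | _ :: v' => Node Empty (trie_path v')
  end.
Fixpoint trie_union (s t : trie) : trie :=
  match s, t with
  | Empty, _ => t
  | _, Empty => s
  | Node a b, Node a' b' => Node (trie_union a a') (trie_union b b')
  | _, _ => s
  end.
Definition root_supports b := foldr (fun v t => trie_union (trie_path v) t) Empty (e8roots b).
Fixpoint sum_in_trie (t : trie) (a b : seq trit) : bool :=
  match t with
  | Empty => false
  | Accept => true
  | Node z nz =>
    match a, b with
    | x :: a', y :: b' =>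
      let sub := match x, y with
        | None, None | Some true, Some false | Some false, Some true => z
        | _, _ => nz
        end in
      sum_in_trie sub a' b'
    | _, _ => false
    end
  end.
Definition root_trie0 := Eval vm_compute in root_supports 0.
Definition root_trie1 := Eval vm_compute in root_supports 1.
Definition root_trie b := if (b == 0) || (b == 2) then root_trie0 else root_trie1.

(** For a word orthogonal to the code, with content [r] in block [b]: what this block contributes to
    the four blocks of [Q], when [rows] are the generators that are the identity on [Q]. *)
Definition block_image (rows : seq (seq word)) (b : nat) (r : seq trit) : seq (seq trit) :=
  [seq [seq trit_opp (tvec_dot r (nth [::] h b)) | h <- g] | g <- rows].
Definition rows_of Q := nth [::] [seq c.2 | c <- systematic_gens] (find (fun c => c.1 == Q) systematic_gens).
Fixpoint all_sums_in (ts : seq trie) (a b : seq (seq trit)) : bool :=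
  match ts, a, b with
  | t :: ts', x :: a', y :: b' => sum_in_trie t x y && all_sums_in ts' a' b'
  | _, _, _ => true
  end.
(** When the other two blocks vanish, the contents of [s1] and [s2] determine the four blocks of
    [Q]. No two roots in [s1] and [s2] may produce roots in all four. *)
Definition six_roots_check (S : seq nat) : bool :=
  match S with
  | s1 :: s2 :: Q => let rows := rows_of Q in
     let ts := map root_trie Q in
     let A := map (block_image rows s1) (e8roots s1) in
     let B := map (block_image rows s2) (e8roots s2) in
     all (fun a => all (fun b => ~~ all_sums_in ts a b) B) A
  | _ => false
  end.
Lemma six_roots_checkP : all six_roots_check (sublists 6 (iota 0 8)).
Proof. by vm_compute. Qed.

(* Five nonzero blocks of total norm at most 24 (in the scaling by 6) allow one block that is not
   a root: a root in block [p] must force two of the other four blocks not to be roots. *)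
Definition five_blocks_check (p : nat) (Q : seq nat) :=
  let rows := rows_of Q in
  all (fun r => 1 < count (fun bv => ~~ sum_in_trie (root_trie bv.1) bv.2 zero8)
                         (zip Q (block_image rows p r)))
    (e8roots p).
(** Two choices of the root block suffice: with at most one non-root among the five blocks, the
    first or the second is a root. *)
Definition five_blocks_check2 (S : seq nat) :=
  if S is p1 :: p2 :: Q then five_blocks_check p1 (p2 :: Q) && five_blocks_check p2 (p1 :: Q)
  else false.
Lemma five_blocks_checkP : all five_blocks_check2 (sublists 5 (iota 0 8)).
Proof. by vm_compute. Qed.

Arguments rows_of : simpl never.
Arguments systematic_gens : simpl never.
Arguments code_gens : simpl never.

(** * Arithmetic of trits and words *)

Lemma trit_addA : associative trit_add. Proof. by do 3![case=> [[]|]]. Qed.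
Lemma trit_addC : commutative trit_add. Proof. by do 2![case=> [[]|]]. Qed.
Lemma trit_add0 : left_id trit0 trit_add. Proof. by []. Qed.
Lemma trit_mulDr a : {morph trit_mul a : x y / trit_add x y}. Proof. by move: a; do 3![case=> [[]|]]. Qed.
Lemma trit_add_eq0 x y : trit_add x y = trit0 -> x = trit_opp y.
Proof. by case: x => [[]|]; case: y => [[]|]. Qed.
Lemma trit_mulCA a b c : trit_mul b (trit_mul a c) = trit_mul a (trit_mul b c).
Proof. by case: a => [[]|]; case: b => [[]|]; case: c => [[]|]. Qed.
Lemma trit_mulr0 a : trit_mul a trit0 = trit0. Proof. by case: a => [[]|]. Qed.
Lemma trit_oppD : {morph trit_opp : x y / trit_add x y}. Proof. by do 2![case=> [[]|]]. Qed.

HB.instance Definition _ := Monoid.isComLaw.Build trit trit0 trit_add trit_addA trit_addC trit_add0.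

Lemma size_map2 (A : Type) (f : A -> A -> A) s t :
  size s = size t -> size (map2 f s t) = size s.
Proof. by elim: s t => [|x s IHs] [|y t] //= [/IHs->]. Qed.

Lemma nth_map2 (A : Type) (f : A -> A -> A) x0 s t i : size s = size t -> i < size s ->
  nth x0 (map2 f s t) i = f (nth x0 s i) (nth x0 t i).
Proof. by elim: s t i => [|x s IHs] [|y t] [|i] //= [st] lt_is; rewrite IHs. Qed.

Lemma tvec_dotD t a b : size a = size b -> tvec_dot t (tvec_add a b) = trit_add (tvec_dot t a) (tvec_dot t b).
Proof.
elim: t a b => [|x t IHt] [|y a] [|z b] //= [/IHt ->].
by rewrite trit_mulDr !trit_addA; congr trit_add; rewrite -!trit_addA; congr trit_add; rewrite trit_addC.
Qed.

Lemma tvec_dotZ t c a : tvec_dot t (tvec_scale c a) = trit_mul c (tvec_dot t a).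
Proof.
elim: t a => [|x t IHt] [|y a] //=; rewrite ?trit_mulr0 //.
by rewrite IHt trit_mulDr trit_mulCA.
Qed.

Lemma word_dotE x y :
  word_dot x y = \big[trit_add/trit0]_(b <- iota 0 8) tvec_dot (nth [::] x b) (nth [::] y b).
Proof. by rewrite /word_dot [iota 0 8]/= !big_cons big_nil. Qed.

Definition word_ok (r : word) := (size r == 8) && all (fun v => size v == 8) r.

Lemma word_ok_nth r b : word_ok r -> b < 8 -> size (nth [::] r b) = 8.
Proof. by case/andP=> /eqP r8 /(all_nthP [::]) sz b8; apply/eqP/sz; rewrite r8. Qed.

Lemma word_dotD t x y : word_ok x -> word_ok y ->
  word_dot t (word_add x y) = trit_add (word_dot t x) (word_dot t y).
Proof.
move=> wx wy; rewrite !word_dotE -big_split; apply: eq_big_seq => b.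
rewrite mem_iota => /= b8; rewrite nth_map2; first by rewrite tvec_dotD // !word_ok_nth.
  by case/andP: wx => /eqP-> _; case/andP: wy => /eqP->.
by case/andP: wx => /eqP->.
Qed.

Lemma word_dotZ t c x : word_ok x -> word_dot t (word_scale c x) = trit_mul c (word_dot t x).
Proof.
move=> wx; rewrite !word_dotE (big_morph _ (trit_mulDr c) (trit_mulr0 c)); apply: eq_big_seq => b.
rewrite mem_iota => /= b8; rewrite (nth_map [::]) ?tvec_dotZ //.
by case/andP: wx => /eqP->.
Qed.

Lemma word_ok_scale c x : word_ok x -> word_ok (word_scale c x).
Proof.
case/andP=> x8 /allP sz; rewrite /word_ok size_map x8 all_map; apply/allP => v /sz /=.
by rewrite size_map.
Qed.

Lemma word_ok_add x y : word_ok x -> word_ok y -> word_ok (word_add x y).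
Proof.
move=> wx wy; have [/eqP x8 /eqP y8] : size x == 8 /\ size y == 8 by case/andP: wx; case/andP: wy.
have xy : size x = size y by rewrite x8.
rewrite /word_ok size_map2 // x8 eqxx /=; apply/(all_nthP [::]) => i; rewrite size_map2 // x8 => i8.
by rewrite nth_map2 ?x8 // size_map2 !word_ok_nth.
Qed.

Lemma word_ok_comb p g : all word_ok g -> word_ok (word_comb p g).
Proof.
elim: p g => [|a p IHp] [|r g] //= /andP[wr /IHp wg].
by case: a => [a|] //; apply: word_ok_add => //; apply: word_ok_scale.
Qed.

Lemma word_dot_comb t p g :
    all word_ok g -> {in g, forall r, word_dot t r = trit0} ->
  word_dot t (word_comb p g) = trit0.
Proof.
have z0 : word_dot t word0 = trit0.
  rewrite word_dotE big1_seq // => b; rewrite mem_iota => /= b8; rewrite nth_nseq b8.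
  by elim: (nth _ t b) 8 => [|x s IHs] [|n] //=; rewrite trit_mulr0 IHs.
elim: p g => [|a p IHp] [|r g] //= /andP[wr wg] orth.
have orth' : {in g, forall r, word_dot t r = trit0} by move=> r' r'g; apply: orth; rewrite inE r'g orbT.
case: a => [a|]; last exact: IHp.
rewrite word_dotD ?word_ok_scale ?word_ok_comb // word_dotZ // IHp // orth ?mem_head //.
by case: a.
Qed.

Lemma subseq_sublists s l : subseq s l -> s \in sublists (size s) l.
Proof.
elim: l s => [|x l IHl] [|y s] //=; rewrite mem_cat.
case: eqP => [-> /IHl sl|_ /IHl ->]; last by rewrite orbT.
by rewrite map_f.
Qed.

Lemma tvec_dot_unit v i : size v = 8 -> i < 8 -> tvec_dot v (unit8 i) = nth trit0 v i.
Proof.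
have tmulC x y : trit_mul x y = trit_mul y x by move: x y; do 2![case=> [[]|]].
have t0r x : trit_add x trit0 = x by rewrite trit_addC.
do 9![case: v => [|? v] //]; move=> _.
by do 8![case: i => [|i]; first by rewrite /= !trit_mulr0 ?t0r tmulC]; case: i.
Qed.

Lemma tvec_dot_zero v : tvec_dot v zero8 = trit0.
Proof. by rewrite /zero8; elim: v 8 => [|x s IHs] [|n] //=; rewrite trit_mulr0 IHs. Qed.

Lemma tvec_zero_dot w : tvec_dot zero8 w = trit0.
Proof. by rewrite /zero8; elim: w 8 => [|x s IHs] [|n] //=; rewrite IHs. Qed.

(** * Words orthogonal to the ternary code *)

Section Words.
Variable t : word.
Hypothesis t_wf : word_ok t.
Hypothesis t_orth : {in code_gens, forall g, word_dot t g = trit0}.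

Lemma rows_of_in Q : Q \in sublists 4 (iota 0 8) -> (Q, rows_of Q) \in systematic_gens.
Proof.
move=> Qin; rewrite /rows_of.
have : Q \in unzip1 systematic_gens by have -> : unzip1 systematic_gens = sublists 4 (iota 0 8) by vm_compute.
case/mapP => c c_in ->; have hasc : has (fun c' => c'.1 == c.1) systematic_gens by apply/hasP; exists c.
set f := find _ _; have f_lt : f < size systematic_gens by rewrite -has_find.
have := nth_find c hasc; rewrite -/f => /eqP <-; rewrite (nth_map c) // -surjective_pairing.
by rewrite mem_nth.
Qed.

Lemma rows_ofP Q : Q \in sublists 4 (iota 0 8) ->
  [/\ size (rows_of Q) = 4, {in rows_of Q, forall g, size g = 8} &
   {in iota 0 4 & iota 0 8, forall j i, let r := nth [::] (nth [::] (rows_of Q) j) i in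
     word_comb (info_part r) code_gens = r /\
     {in iota 0 4, forall j', nth [::] r (nth 0 Q j') = if j' == j then unit8 i else zero8}}].
Proof.
move=> /rows_of_in /(allP systematic_gens_ok); rewrite /systematic_ok /fst /snd.
case/and3P=> /eqP rows4 /allP rows8 /allP certQ; split=> // [g /rows8/eqP // | j i j4 i8].
have /allP/(_ i i8)/andP[/eqP row_comb /allP row_id] := certQ j j4.
by split=> // j' /row_id/eqP.
Qed.

(** The generator of index [(j, i)] is a unit vector on the [j]-th block of [Q] and zero on the rest
    of [Q]. Orthogonality to it therefore expresses one coordinate of that block by the blocks in
    [I], all others being zero. *)
Lemma block_image_sum Q (I : seq nat) j : Q \in sublists 4 (iota 0 8) -> j < 4 ->
  uniq (I ++ Q) -> all (gtn 8) I ->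
  {in iota 0 8, forall b, b \notin I ++ Q -> nth [::] t b = zero8} ->
  nth [::] t (nth 0 Q j) =
  foldr tvec_add zero8 [seq nth [::] (block_image (rows_of Q) s (nth [::] t s)) j | s <- I].
Proof.
move=> Qin j4 /[!cat_uniq]/and3P[I_uniq /hasPn QI Q_uniq] I8 t_out.
have [rows4 rows8 certQ] := rows_ofP Qin.
have Q4 : size Q = 4.
  by have /(allP (_ : all (fun s => size s == 4) (sublists 4 (iota 0 8))))/eqP := Qin; apply; vm_compute.
have Q8 : all (gtn 8) Q.
  by have /(allP (_ : all (all (gtn 8)) (sublists 4 (iota 0 8)))) := Qin; apply; vm_compute.
have row8 : size (nth [::] (rows_of Q) j) = 8 by apply/rows8/mem_nth; rewrite rows4.
have img8 s : size (nth [::] (block_image (rows_of Q) s (nth [::] t s)) j) = 8.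
  by rewrite (nth_map [::]) ?rows4 // size_map.
have Qj8 : nth 0 Q j < 8 by apply: (allP Q8); rewrite mem_nth ?Q4.
have size_fold (S : seq nat) :
    size (foldr tvec_add zero8 [seq nth [::] (block_image (rows_of Q) s (nth [::] t s)) j | s <- S]) = 8.
  by elim: S => [|x S IHS] //=; rewrite size_map2 img8 ?IHS.
apply: (@eq_from_nth _ trit0) => [|i]; first by rewrite size_fold word_ok_nth.
rewrite word_ok_nth // => i8.
have -> : nth trit0 (foldr tvec_add zero8
      [seq nth [::] (block_image (rows_of Q) s (nth [::] t s)) j | s <- I]) i =
    trit_opp (\big[trit_add/trit0]_(s <- I)
      tvec_dot (nth [::] t s) (nth [::] (nth [::] (nth [::] (rows_of Q) j) i) s)).
  rewrite (big_morph _ trit_oppD (erefl _)); elim: (I) => [|x S IHS].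
    by rewrite big_nil /= nth_nseq i8.
  rewrite big_cons /= nth_map2 ?size_fold ?img8 // IHS; congr trit_add.
  by rewrite (nth_map [::]) ?rows4 // (nth_map [::]) ?row8.
apply: trit_add_eq0.
have jr : j \in iota 0 4 by rewrite mem_iota.
have ir : i \in iota 0 8 by rewrite mem_iota.
have [row_comb row_id] := certQ j i jr ir.
set r := nth [::] (nth [::] (rows_of Q) j) i in row_comb row_id *.
have gens_wf : all word_ok code_gens by vm_compute.
have := word_dot_comb (info_part r) gens_wf t_orth; rewrite row_comb word_dotE => {row_comb} r_orth.
rewrite -[RHS]r_orth [RHS](bigID (fun b => b \in Q)); congr (trit_add _ _).
  rewrite -big_filter (perm_big Q); last first.
    apply: uniq_perm => [||b]; rewrite ?filter_uniq ?iota_uniq // mem_filter.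
    by rewrite mem_iota /=; case bQ: (b \in Q) => //=; apply: (allP Q8).
  rewrite -[in RHS](mkseq_nth 0 Q) big_map Q4 (bigD1_seq j) ?iota_uniq //=.
  rewrite (row_id j jr) eqxx tvec_dot_unit ?word_ok_nth //.
  rewrite big1_seq ?[trit_add _ trit0]trit_addC // => j' /andP[/negPf j'j j'4].
  by rewrite (row_id j' j'4) j'j tvec_dot_zero.
transitivity (\big[trit_add/trit0]_(b <- iota 0 8 | b \in I) tvec_dot (nth [::] t b) (nth [::] r b)).
  rewrite -[RHS]big_filter; apply: perm_big; apply: uniq_perm => [||b]; rewrite ?filter_uniq ?iota_uniq //.
  by rewrite mem_filter mem_iota; case bI: (b \in I) => //; have /= -> := allP I8 b bI.
rewrite big_mkcond [RHS]big_mkcond; apply: eq_big_seq => b b8.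
case: ifPn => bI; first by rewrite ifT //; apply/negP => /QI; rewrite /= bI.
by case: ifPn => // bQ; rewrite t_out ?tvec_zero_dot // mem_cat negb_or bI.
Qed.

(** The trie sees only the support of the sum, which is tested without forming the sum. *)
Lemma sum_in_trieE T a b : size a = size b ->
  sum_in_trie T a b = sum_in_trie T (tvec_add a b) (nseq (size a) trit0).
Proof.
elim: T a b => [||z IHz nz IHnz] [|x a] [|y b] //= [ab].
by case: x => [[]|]; case: y => [[]|] /=; rewrite 1?IHz 1?IHnz // size_map2.
Qed.

Lemma roots_mem b v : b < 8 -> v \in e8roots b -> sum_in_trie (root_trie b) v zero8.
Proof.
have : all (fun b => all (fun v => sum_in_trie (root_trie b) v zero8) (e8roots b)) (iota 0 8) by vm_compute.
by move/allP=> h b8; have /allP := h b ltac:(by rewrite mem_iota); apply.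
Qed.

Definition nonzero_blocks := [seq b <- iota 0 8 | nth [::] t b != zero8].
Definition nonroots := [seq b <- nonzero_blocks | nth [::] t b \notin e8roots b].

Lemma tvec_add0 v : tvec_add v (nseq (size v) trit0) = v.
Proof. by rewrite /tvec_add; elim: v => [|x v IHv] //=; rewrite IHv; case: x => [[]|]. Qed.

Lemma size_block_image Q s r j : Q \in sublists 4 (iota 0 8) -> j < 4 ->
  size (nth [::] (block_image (rows_of Q) s r) j) = 8.
Proof.
move=> Qin j4.
have [rows4 rows8 _] := rows_ofP Qin.
rewrite (nth_map [::]) ?rows4 // size_map; apply/rows8/mem_nth.
by rewrite rows4.
Qed.

Lemma subseq_nonzero_blocks : subseq nonzero_blocks (iota 0 8). Proof. exact: filter_subseq. Qed.

Lemma zero_out b : b \in iota 0 8 -> b \notin nonzero_blocks -> nth [::] t b = zero8.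
Proof. by move=> b8; rewrite mem_filter b8 andbT negbK => /eqP. Qed.

Lemma sublists4P : all (fun Q => [&& size Q == 4, uniq Q & all (gtn 8) Q]) (sublists 4 (iota 0 8)).
Proof. by vm_compute. Qed.

Lemma root_in b : b \in nonzero_blocks -> b \notin nonroots -> nth [::] t b \in e8roots b.
Proof. by move=> b_nz; rewrite mem_filter b_nz andbT negbK. Qed.

(** The nonzero blocks lie in some set [Q] of four blocks. The word vanishes outside [Q], and these
    outer blocks determine those of [Q], which therefore vanish too. *)
Lemma nonzero_blocks_le4 : size nonzero_blocks <= 4 -> nonzero_blocks = [::].
Proof.
move=> nz4; have /subseq_sublists nz_in := subseq_nonzero_blocks.
have : all (fun k => all (fun s => has (fun Q => all (mem Q) s) (sublists 4 (iota 0 8)))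
    (sublists k (iota 0 8))) (iota 0 5) by vm_compute.
have k_in : size nonzero_blocks \in iota 0 5 by rewrite mem_iota ltnS.
move/allP/(_ _ k_in)/allP/(_ _ nz_in)/hasP => [Q Qin /allP nzQ].
have /(allP sublists4P)/and3P[/eqP Q4 Q_uniq Q8] := Qin.
case nzE: nonzero_blocks => [|b s] //; have b_nz : b \in nonzero_blocks by rewrite nzE mem_head.
have /nthP-/(_ 0)[j] := nzQ b b_nz; rewrite Q4 => j4 b_eq.
have /= := block_image_sum (I := [::]) Qin j4 Q_uniq isT; rewrite b_eq => b0.
move: b_nz; rewrite mem_filter b0 ?eqxx // => b' b'8 b'Q.
by apply: zero_out => //; apply: contra b'Q; apply: nzQ.
Qed.

Lemma five_blocks_bound p Q : Q \in sublists 4 (iota 0 8) -> perm_eq (p :: Q) nonzero_blocks ->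
  p \notin nonroots -> five_blocks_check p Q -> 1 < size nonroots.
Proof.
move=> Qin pQ p_root /allP weight_check.
have /(allP sublists4P)/and3P[/eqP Q4 Q_uniq Q8] := Qin.
have p_nz : p \in nonzero_blocks by rewrite -(perm_mem pQ) mem_head.
have p8 : p < 8 by move: p_nz; rewrite mem_filter mem_iota => /andP[].
have pQ_uniq : uniq (p :: Q) by rewrite (perm_uniq pQ) filter_uniq ?iota_uniq.
have imgE : block_image (rows_of Q) p (nth [::] t p) = [seq nth [::] t b | b <- Q].
  have sz : size (block_image (rows_of Q) p (nth [::] t p)) = 4.
    by have [rows4 _ _] := rows_ofP Qin; rewrite size_map.
  apply: (@eq_from_nth _ [::]) => [|j]; rewrite sz ?size_map ?Q4 // => j4.
  rewrite (nth_map 0) ?Q4 // (@block_image_sum Q [:: p] j) //=; last 2 first.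
  - by rewrite p8.
  - by move=> b b8; rewrite (perm_mem pQ); apply: zero_out.
  by rewrite -[in LHS](tvec_add0 (nth _ _ j)) size_block_image.
have := weight_check _ (root_in p_nz p_root); rewrite imgE => /leq_trans; apply.
have -> : zip Q [seq nth [::] t b | b <- Q] = [seq (b, nth [::] t b) | b <- Q].
  by elim: (Q) => [|b s IHs] //=; rewrite IHs.
rewrite count_map size_filter -(permP pQ) /=; apply: leq_trans (leq_addl _ _).
rewrite (@eq_in_count _ _
  (fun b => (b < 8) && ~~ sum_in_trie (root_trie b) (nth [::] t b) zero8)); last first.
  by move=> b bQ; rewrite (allP Q8 b bQ : b < 8).
by apply: sub_count => b /andP[b8]; apply: contra => /roots_mem; apply.
Qed.

Lemma six_roots_contra s1 s2 Q : Q \in sublists 4 (iota 0 8) -> nonzero_blocks = [:: s1, s2 & Q] ->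
  nonroots = [::] -> ~~ six_roots_check (s1 :: s2 :: Q).
Proof.
move=> Qin nzE nonroot0.
have /(allP sublists4P)/and3P[/eqP Q4 Q_uniq Q8] := Qin.
have is_root b : b \in nonzero_blocks -> nth [::] t b \in e8roots b.
  by move=> b_nz; apply: root_in; rewrite ?nonroot0.
have nz8 b : b \in nonzero_blocks -> b < 8 by rewrite mem_filter mem_iota => /andP[].
have nz_uniq : uniq nonzero_blocks by rewrite filter_uniq ?iota_uniq.
have [s1_nz s2_nz] : s1 \in nonzero_blocks /\ s2 \in nonzero_blocks by rewrite nzE !inE !eqxx orbT.
apply/negP => /allP /(_ _ (map_f _ (is_root _ s1_nz)))/allP /(_ _ (map_f _ (is_root _ s2_nz))).
move/negP; apply.
set a := block_image _ s1 _; set b := block_image _ s2 _.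
have [sza szb] : size a = 4 /\ size b = 4.
  by have [rows4 _ _] := rows_ofP Qin; rewrite !size_map.
have allsumP ts x y : size ts = 4 -> size x = 4 -> size y = 4 ->
    (forall j, j < 4 -> sum_in_trie (nth Empty ts j) (nth [::] x j) (nth [::] y j)) -> all_sums_in ts x y.
  do 5![case: ts => [|? ts] //]; do 5![case: x => [|? x] //]; do 5![case: y => [|? y] //].
  by move=> _ _ _ h; rewrite /= (h 0) // (h 1) // (h 2) // (h 3).
apply: allsumP => [|||j j4] //; first by rewrite size_map.
rewrite (nth_map 0) ?Q4 // sum_in_trieE ?size_block_image //.
have Qj_nz : nth 0 Q j \in nonzero_blocks by rewrite nzE !inE mem_nth ?Q4 ?orbT.
have <- : nth [::] t (nth 0 Q j) = tvec_add (nth [::] a j) (nth [::] b j).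
  rewrite (@block_image_sum Q [:: s1; s2] j) //=; last 3 first.
  - by move: nz_uniq; rewrite nzE.
  - by rewrite !nz8.
  - by move=> c c8 c_out; apply: zero_out => //; rewrite nzE.
  by rewrite -[X in tvec_add _ X = _](_ : nth [::] b j = _) // -[LHS]tvec_add0 size_block_image.
exact: roots_mem (nz8 _ Qj_nz) (is_root _ Qj_nz).
Qed.

(** In units of norm 4 a root block costs 1 and any other nonzero block at least 2, so the bound 6
    stands for norm 24. Five nonzero blocks leave room for one non-root, six for none; the two
    searches exclude these cases. *)
Lemma no_short_word : size nonzero_blocks + size nonroots <= 6 -> nonzero_blocks = [::].
Proof.
move=> bound; have [|nz_gt4] := leqP (size nonzero_blocks) 4; first exact: nonzero_blocks_le4.
have /subseq_sublists nz_in := subseq_nonzero_blocks.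
have [nz5 | nz6] : size nonzero_blocks = 5 \/ size nonzero_blocks = 6.
  move: nz_gt4 (leq_trans (leq_addr _ _) bound).
  by case: (size nonzero_blocks) => [|[|[|[|[|[|[|]]]]]]] //; auto.
- rewrite nz5 in nz_in bound.
  have : all (fun s => if s is p1 :: p2 :: Q then (p2 :: Q \in sublists 4 (iota 0 8)) &&
     (p1 :: Q \in sublists 4 (iota 0 8)) else false) (sublists 5 (iota 0 8)) by vm_compute.
  move/allP/(_ _ nz_in); have := allP five_blocks_checkP _ nz_in.
  case nzE: nonzero_blocks => [|p1 [|p2 Q]] // /andP[chk1 chk2] /andP[Qin1 Qin2].
  have nonroots1 : size nonroots <= 1 by [].
  have [p1_bad|p1_root] := boolP (p1 \in nonroots); last first.
    suff : 1 < size nonroots by rewrite ltnNge nonroots1.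
    by apply: (five_blocks_bound Qin1) p1_root chk1; rewrite nzE.
  have p12 : p1 != p2.
    have : uniq nonzero_blocks by rewrite filter_uniq ?iota_uniq.
    by rewrite nzE /= inE negb_or -andbA => /and3P[].
  have p2_root : p2 \notin nonroots.
    apply/negP => p2_bad; have : {subset [:: p1; p2] <= nonroots}.
      by move=> b; rewrite !inE => /orP[]/eqP->.
    move/uniq_leq_size; rewrite /= inE p12 => /(_ isT).
    by rewrite leqNgt ltnS nonroots1.
  suff : 1 < size nonroots by rewrite ltnNge nonroots1.
  apply: (five_blocks_bound Qin2) p2_root chk2; rewrite nzE.
  by apply/permP => f /=; rewrite addnCA.
rewrite nz6 in nz_in bound.
have nonroot0 : nonroots = [::] by apply: size0nil; move: bound; case: (size _).
have : all (fun s => if s is p1 :: p2 :: Q then Q \in sublists 4 (iota 0 8) else false)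
    (sublists 6 (iota 0 8)) by vm_compute.
move/allP/(_ _ nz_in); have := allP six_roots_checkP _ nz_in.
case nzE: nonzero_blocks => [|s1 [|s2 Q]] // no_sum Qin.
by have := six_roots_contra Qin nzE nonroot0; rewrite no_sum.
Qed.
End Words.

Local Open Scope ring_scope.

(** * The lattice *)

Lemma nat_isumE n F : nat_isum n F = \sum_(c < n) F c.
Proof.
rewrite -(big_mkord xpredT F) /nat_isum /index_iota subn0.
by elim: (iota 0 n) => [|c s IHs]; rewrite ?big_nil ?big_cons //= IHs.
Qed.

(** * Matrices of size 32 as tables of integers *)

Definition tabulate (f : nat -> nat -> int) := [seq [seq f i j | j <- iota 0 32] | i <- iota 0 32].
Definition table_mx (l : seq (seq int)) : 'M[int]_32 := \matrix_(i, j) get l i j.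
Definition row_addmul (x : int) (r s : seq int) : seq int :=
  if x is Posz 0 then s else map2 (fun y z => intZmod.addz (intRing.mulz x y) z) r s.
Definition table_mul (a b : seq (seq int)) : seq (seq int) :=
  [seq foldr (fun p => row_addmul p.1 p.2) (nseq 32 0) (zip r b) | r <- a].
Definition table_tr a := tabulate (fun i j => get a j i).
Definition table_scalar (c : int) := tabulate (fun i j => if i == j then c else 0).
Definition table_opp a := tabulate (fun i j => - get a i j).

Lemma get_tabulate f (i j : nat) : (i < 32)%N -> (j < 32)%N -> get (tabulate f) i j = f i j.
Proof.
by move=> i32 j32; rewrite /get (nth_map 0%N) ?size_iota // (nth_map 0%N) ?size_iota // !nth_iota.
Qed.

Definition square_table (a : seq (seq int)) := (size a == 32) && all (fun r => size r == 32) a.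

Lemma table_mxM a b : square_table a -> square_table b -> table_mx a *m table_mx b = table_mx (table_mul a b).
Proof.
case/andP=> /eqP a32 /all_nthP a_rows /andP[/eqP b32 /all_nthP b_rows].
apply/matrixP => i j; rewrite !mxE /get (nth_map [::]) ?a32 //.
set r := nth [::] a i; have r32 : size r = 32 by apply/eqP/a_rows; rewrite a32.
transitivity (\sum_(p <- zip r b) p.1 * nth 0 p.2 j).
  rewrite (big_nth (0, [::])) size_zip r32 b32 minnn big_mkord.
  by apply: eq_bigr => k _; rewrite !mxE nth_zip ?r32 ?b32.
have : all (fun p => size p.2 == 32) (zip r b).
  apply/(all_nthP (0, [::])) => k; rewrite size_zip r32 b32 => k32.
  by rewrite nth_zip ?r32 ?b32 //; apply: b_rows; rewrite b32.
set F := foldr _ _; suff : forall l, all (fun p => size p.2 == 32) l ->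
    size (F l) = 32 /\ \sum_(p <- l) p.1 * nth 0 p.2 j = nth 0 (F l) j.
  by move=> h /h[].
elim=> [_|[x s] l IHl /= /andP[/eqP s32 /IHl[Fl32 Fl]]].
  by split=> //; rewrite big_nil [F _](_ : _ = nseq 32 (0 : int)) // nth_nseq ltn_ord.
rewrite big_cons Fl /= /row_addmul; case: x => [[|x]|x]; rewrite ?mul0r ?add0r //.
  by rewrite size_map2 ?s32 // nth_map2 ?s32 ?Fl32.
by rewrite size_map2 ?s32 // nth_map2 ?s32 ?Fl32.
Qed.
Lemma table_mx_tr a : (table_mx a)^T = table_mx (table_tr a).
Proof. by apply/matrixP => i j; rewrite !mxE get_tabulate. Qed.
Lemma table_mx_scalar c : table_mx (table_scalar c) = c%:M.
Proof. by apply/matrixP => i j; rewrite !mxE get_tabulate // -val_eqE; case: eqP. Qed.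
Lemma table_mx_opp a : - table_mx a = table_mx (table_opp a).
Proof. by apply/matrixP => i j; rewrite !mxE get_tabulate. Qed.

(** * The matrices [M], [N] and [K], and left multiplication by the quaternions [i] and [j] *)

Definition I_entry i j : int := if (i %/ 4 == j %/ 4)%N then
  get [:: [:: 0; 1; 0; 0]; [:: -1; 0; 0; 0]; [:: 0; 0; 0; 1]; [:: 0; 0; -1; 0]] (i %% 4)%N (j %% 4)%N else 0.
Definition J_entry i j : int := if (i %/ 4 == j %/ 4)%N then
  get [:: [:: 0; 0; 1; 0]; [:: 0; 0; 0; -1]; [:: -1; 0; 0; 0]; [:: 0; 1; 0; 0]] (i %% 4)%N (j %% 4)%N else 0.
Definition M_table := Eval vm_compute in tabulate M_entry.
Definition N_table := Eval vm_compute in tabulate N_entry.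
Definition I_table := Eval vm_compute in tabulate I_entry.
Definition J_table := Eval vm_compute in tabulate J_entry.
Definition mat_M := table_mx M_table.
Definition mat_N := table_mx N_table.
Definition mat_I := table_mx I_table.
Definition mat_J := table_mx J_table.

Lemma mat_M_sqr : mat_M *m mat_M = (-11)%:M.
Proof. by rewrite table_mxM // -table_mx_scalar; congr table_mx; vm_compute. Qed.
Lemma mat_M_tr : mat_M^T = - mat_M.
Proof. by rewrite table_mx_tr table_mx_opp; congr table_mx; vm_compute. Qed.
Lemma mat_N_NT : mat_N *m mat_N^T = 3%:M.
Proof. by rewrite table_mx_tr table_mxM // -table_mx_scalar; congr table_mx; vm_compute. Qed.
Lemma mat_NT_N : mat_N^T *m mat_N = 3%:M.
Proof. by rewrite table_mx_tr table_mxM // -table_mx_scalar; congr table_mx; vm_compute. Qed.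
Lemma mat_I_sqr : mat_I *m mat_I = (-1)%:M.
Proof. by rewrite table_mxM // -table_mx_scalar; congr table_mx; vm_compute. Qed.
Lemma mat_J_sqr : mat_J *m mat_J = (-1)%:M.
Proof. by rewrite table_mxM // -table_mx_scalar; congr table_mx; vm_compute. Qed.
Lemma mat_I_tr : mat_I^T = - mat_I.
Proof. by rewrite table_mx_tr table_mx_opp; congr table_mx; vm_compute. Qed.
Lemma mat_J_tr : mat_J^T = - mat_J.
Proof. by rewrite table_mx_tr table_mx_opp; congr table_mx; vm_compute. Qed.
Lemma mat_I_J : mat_I *m mat_J = - (mat_J *m mat_I).
Proof. by rewrite !table_mxM // table_mx_opp; congr table_mx; vm_compute. Qed.
Lemma mat_M_I : mat_M *m mat_I = mat_I *m mat_M.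
Proof. by rewrite !table_mxM //; congr table_mx; vm_compute. Qed.
Lemma mat_M_J : mat_M *m mat_J = mat_J *m mat_M.
Proof. by rewrite !table_mxM //; congr table_mx; vm_compute. Qed.

(** Chinese remaindering: [K] is [N] modulo 2 and [M] modulo 3. *)
Definition mat_K : 'M[int]_32 := 3%:Z *: mat_N - 2%:Z *: mat_M.

(** The scalar part is [1 + 9 * 3 + 4 * 11 = 72], and the mixed terms carry the factor
    [3 * 2 = 6]. *)
Lemma mat_K_KT : 1%:M + mat_K *m mat_K^T = 6%:Z *: ((6%:M - mat_N *m mat_M^T) + (6%:M - mat_N *m mat_M^T)^T).
Proof.
have MMT : mat_M *m mat_M^T = 11%:M by rewrite mat_M_tr mulmxN mat_M_sqr -raddfN.
rewrite /mat_K ![(_ - _)^T]linearB /= ![(_ *: _)^T]linearZ /= trmx_mul trmxK tr_scalar_mx.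
rewrite mulmxBl !mulmxBr -!scalemxAl -!scalemxAr mat_N_NT MMT.
move: (mat_N *m mat_M^T) (mat_M *m mat_N^T) => X Y; apply/matrixP => i j; rewrite !mxE.
by case: (i == j); rewrite ?mulr1n ?mulr0n; ring.
Qed.

Lemma mat_KT_K : 1%:M + mat_K^T *m mat_K = 6%:Z *: (12%:M - mat_N^T *m mat_M - mat_M^T *m mat_N).
Proof.
have MTM : mat_M^T *m mat_M = 11%:M by rewrite mat_M_tr mulNmx mat_M_sqr -raddfN.
rewrite /mat_K ![(_ - _)^T]linearB /= ![(_ *: _)^T]linearZ /=.
rewrite mulmxBl !mulmxBr -!scalemxAl -!scalemxAr mat_NT_N MTM.
move: (mat_N^T *m mat_M) (mat_M^T *m mat_N) => X Y; apply/matrixP => i j; rewrite !mxE.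
by case: (i == j); rewrite ?mulr1n ?mulr0n; ring.
Qed.

Definition lat6 : pred 'rV[int]_(32 + 32) := syslat 6 mat_K.

(** After doubling only the congruence [K = M] modulo 3 matters. The rows of the frames have this
    form; for [z = 0] these vectors, and likewise those of [lat6_N], are test vectors that isolate
    the condition modulo one prime. *)
Lemma lat6_double p z : lat6 (row_mx (2%:Z *: p) (2%:Z *: (p *m mat_M + 3%:Z *: z))).
Proof.
apply/syslatP; exists (p *m mat_M - p *m mat_N + z); rewrite row_mxKl; congr row_mx.
rewrite mulmxBr -!scalemxAl -!scalemxAr.
by apply/rowP => j; rewrite !mxE; ring.
Qed.

Lemma lat6_M p : lat6 (row_mx (2%:Z *: p) (2%:Z *: (p *m mat_M))).
Proof. by have := lat6_double p 0; rewrite scaler0 addr0. Qed.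

Lemma lat6_N p : lat6 (row_mx (3%:Z *: p) (3%:Z *: (p *m mat_N))).
Proof.
apply/syslatP; exists (p *m mat_M - p *m mat_N); rewrite row_mxKl; congr row_mx.
rewrite mulmxBr -!scalemxAl -!scalemxAr.
by apply/rowP => j; rewrite !mxE; ring.
Qed.

Definition seq_row n (l : seq int) : 'rV[int]_n := \row_j nth 0 l j.

Definition syslat_check (m : nat) (k : seq (seq int)) (u w : seq int) :=
  all (fun j => dvdn m (absz (intZmod.addz (nth 0 w j)
    (intZmod.oppz (nat_isum 32 (fun i => intRing.mulz (nth 0 u i) (get k i j))))))) (iota 0 32).

Lemma syslat_seq_row m k u w : syslat_check m k u w ->
  syslat m (table_mx k) (row_mx (seq_row 32 u) (seq_row 32 w)).
Proof.
move=> /allP weight_check; apply/forallP => j; rewrite row_mxKr row_mxKl.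
have /weight_check : nat_of_ord j \in iota 0 32 by rewrite mem_iota ltn_ord.
congr (dvdn _ (absz _)); rewrite !mxE nat_isumE; congr (_ - _).
by apply: eq_bigr => i _; rewrite !mxE.
Qed.

Definition sqnorm32 (u : seq int) := nat_isum 32 (fun j => intRing.mulz (nth 0 u j) (nth 0 u j)).

Lemma ip_seq_row u w :
  ip (row_mx (seq_row 32 u) (seq_row 32 w)) (row_mx (seq_row 32 u) (seq_row 32 w)) = sqnorm32 u + sqnorm32 w.
Proof. by rewrite /sqnorm32 !nat_isumE ip_row_mx; congr (_ + _); apply: eq_bigr => j _; rewrite !mxE. Qed.

Definition K_table := Eval vm_compute in tabulate (fun i j => 3 * get N_table i j - 2 * get M_table i j).
Lemma mat_K_table : mat_K = table_mx K_table.
Proof.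
have -> : K_table = tabulate (fun i j => 3 * get N_table i j - 2 * get M_table i j) by vm_compute.
by apply/matrixP => i j; rewrite !mxE get_tabulate.
Qed.

(** * Norms of single blocks *)

Definition seq_norm (x : seq int) : nat := sumn [seq (absz z ^ 2)%N | z <- x].

Lemma vectors_of_normP n q x : size x = n -> seq_norm x = q -> (q <= 4)%N -> x \in vectors_of_norm n q.
Proof.
elim: n q x => [|n IHn] q [|z x] //; first by move=> _ <-.
move=> [xn]; rewrite [seq_norm _]/(absz z ^ 2 + seq_norm x)%N => zx q4; apply/flattenP.
have z_le : (absz z ^ 2 <= q)%N by rewrite -zx leq_addr.
exists [seq z :: s | s <- vectors_of_norm n (q - absz z ^ 2)].
  apply/mapP; exists z => //; rewrite mem_filter z_le !inE.
  have : (absz z <= 2)%N by rewrite leqNgt; apply/negP => z_gt; move: z_le; nia.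
  by case: z {zx z_le} => [[|[|[|]]]|[|[|]]].
by apply: map_f; apply: IHn => //; [rewrite -zx addKn|lia].
Qed.

Lemma e8roots_short b x : (b < 8)%N -> x \in vectors_of_norm 8 4 -> even_parity b x ->
  map trit_of_int x \in e8roots b.
Proof.
have : all (fun b => e8roots b ==
    [seq map trit_of_int x | x <- vectors_of_norm 8 4 & even_parity b x]) (iota 0 8).
  by vm_compute.
move/allP=> h b8 xs par; rewrite (eqP (h b ltac:(by rewrite mem_iota))) map_f //.
by rewrite mem_filter par.
Qed.

Fixpoint bitlists n : seq (seq bool) :=
  if n is n'.+1 then [seq false :: s | s <- bitlists n'] ++ [seq true :: s | s <- bitlists n'] else [:: [::]].

Lemma bitlistsP e : e \in bitlists (size e).
Proof.
elim: e => [|[] e IHe] //=; rewrite mem_cat; last by rewrite map_f.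
by rewrite [X in _ || X]map_f ?orbT.
Qed.

Lemma seq_norm_mod4 x : (seq_norm x = count id [seq odd (absz z) | z <- x] %[mod 4])%N.
Proof.
elim: x => [|z x IHx] //; rewrite [seq_norm _]/(absz z ^ 2 + seq_norm x)%N.
rewrite [count id _]/(odd (absz z) + count id [seq odd (absz z) | z <- x])%N.
rewrite -modnDm IHx -[in RHS]modnDm; congr ((_ + _) %% _)%N.
rewrite -{1}(odd_double_half (absz z)); case: (odd _); move: (_./2) => q.
  have -> : ((true + q.*2) ^ 2 = (q ^ 2 + q) * 4 + 1)%N by rewrite -muln2 /=; ring.
  by rewrite modnMDl.
by have -> : ((false + q.*2) ^ 2 = q ^ 2 * 4)%N; [rewrite -muln2 /=; ring | rewrite modnMl].
Qed.

(** Modulo 4 the norm is the number of odd entries, and the Hamming code is doubly even. *)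
Lemma block_dvd4 b x : (b < 8)%N -> size x = 8 -> even_parity b x -> (4 %| seq_norm x)%N.
Proof.
move=> b8 x8 par; rewrite /dvdn seq_norm_mod4.
have : all (fun b => all (fun e => bits_even_parity b e ==> (4 %| count id e)%N) (bitlists 8))
    (iota 0 8) by vm_compute.
move/allP/(_ b); rewrite mem_iota => /(_ b8)/allP.
have := bitlistsP [seq odd (absz z) | z <- x]; rewrite size_map x8 => e_in /(_ _ e_in)/implyP.
exact.
Qed.

Lemma trit_of_int_eq0 z : (trit_of_int z == trit0) = (3 %| z)%Z.
Proof.
rewrite dvdzE /dvdn; case: z => n; rewrite /trit_of_int; last first.
  have -> : (absz (Negz n) %% absz 3 = (n %% 3).+1 %% 3)%N by rewrite -[absz _]/n.+1 -[absz _]/3%N; lia.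
  by case: (n %% 3)%N (ltn_mod n 3) => [|[|[|]]].
by rewrite -[absz _]/n -[absz 3]/3%N; case: (n %% 3)%N (ltn_mod n 3) => [|[|[|]]].
Qed.

(** Here [x = 3 y], where [y] passes the same parity checks since 3 is odd. The norm of [x] is thus
    9 times a multiple of 4. *)
Lemma block_zero b x : (b < 8)%N -> size x = 8 -> even_parity b x -> map trit_of_int x = zero8 ->
  (seq_norm x < 36)%N -> seq_norm x = 0%N.
Proof.
move=> b8 x8 par x0 x_lt.
pose y := [seq (z %/ 3)%Z | z <- x]; have y8 : size y = 8 by rewrite size_map.
have x3 c : (c < 8)%N -> nth 0 x c = nth 0 y c * 3.
  move=> c8; rewrite (nth_map 0) ?x8 // divzK // -trit_of_int_eq0.
  by rewrite -(nth_map 0 trit0) ?x8 // x0 nth_nseq c8.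
have xy : x = [seq z * 3 | z <- y].
  apply: (@eq_from_nth _ 0) => [|c]; first by rewrite size_map x8 y8.
  by rewrite x8 => c8; rewrite x3 // [RHS](nth_map 0) ?y8.
have nrm9 : seq_norm x = (9 * seq_norm y)%N.
  rewrite [in LHS]xy /seq_norm -map_comp; elim: (y) => [|z s IHs] //=.
  by rewrite IHs mulnDr abszM expnMn mulnC.
have : (4 %| seq_norm y)%N.
  apply: (@block_dvd4 b) => //.
  move: par; rewrite {1}xy /even_parity -map_comp; congr (bits_even_parity b _).
  by apply: eq_map => z /=; rewrite abszM oddM andbT.
by case/dvdnP=> q q4; lia.
Qed.

(** The norm is a positive multiple of 4, and a block of norm exactly 4 is a root. *)
Lemma block_cost b x : (b < 8)%N -> size x = 8 -> even_parity b x -> map trit_of_int x != zero8 ->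
  (4 + 4 * (map trit_of_int x \notin e8roots b) <= seq_norm x)%N.
Proof.
move=> b8 x8 par x_neq0; have /dvdnP[q qE] := block_dvd4 b8 x8 par.
have nrm_neq0 : seq_norm x != 0%N.
  apply: contra x_neq0 => /eqP x0; apply/eqP/(@eq_from_nth _ trit0); rewrite size_map x8 // => c c8.
  rewrite (nth_map 0) ?x8 // nth_nseq c8; suff -> : nth 0 x c = 0 by [].
  have : nth 0 x c \in x by rewrite mem_nth ?x8.
  move: (nth 0 x c) x0 => y; rewrite /seq_norm; elim: (x) => [|z s IHs] //= /eqP.
  rewrite addn_eq0 expn_eq0 absz_eq0.
  by case/andP=> /andP[/eqP z0 _] /eqP s0; rewrite inE => /orP[/eqP ->|/(IHs s0)].
have [x4|] := eqVneq (seq_norm x) 4%N.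
  by rewrite x4 e8roots_short ?(vectors_of_normP x8 x4).
by case: (_ \notin _); lia.
Qed.

Lemma trit_of_intE z : trit_of_int z = nth trit0 [:: trit0; trit1; trit2] (absz (z %% 3)%Z).
Proof.
have tr_nat n : trit_of_int (Posz n) = nth trit0 [:: trit0; trit1; trit2] (n %% 3)%N.
  by rewrite /trit_of_int; case: (n %% 3)%N (ltn_mod n 3) => [|[|[|]]].
case: z => n; first by rewrite tr_nat; congr nth; lia.
rewrite /trit_of_int; have -> : absz (Negz n %% 3)%Z = (2 - n %% 3)%N by lia.
by case: (n %% 3)%N (ltn_mod n 3) => [|[|[|]]].
Qed.

Lemma residue_mod3 z : exists2 q, z = 3 * q + (z %% 3)%Z &
  [\/ (z %% 3)%Z = 0, (z %% 3)%Z = 1 | (z %% 3)%Z = 2].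
Proof.
exists (z %/ 3)%Z; first by lia.
have : [|| (z %% 3)%Z == 0, (z %% 3)%Z == 1 | (z %% 3)%Z == 2] by lia.
by case/or3P=> /eqP h; [constructor 1 | constructor 2 | constructor 3].
Qed.

Lemma trit_of_int_eqmod y z : (3 %| y - z)%Z -> trit_of_int y = trit_of_int z.
Proof. by move=> yz; rewrite !trit_of_intE; congr nth; lia. Qed.

Lemma trit_of_intD : {morph trit_of_int : y z / y + z >-> trit_add y z}.
Proof.
move=> y z; have [q yE y3] := residue_mod3 y; have [q' zE z3] := residue_mod3 z.
rewrite [trit_of_int y](@trit_of_int_eqmod _ (y %% 3)%Z); last by lia.
rewrite [trit_of_int z](@trit_of_int_eqmod _ (z %% 3)%Z); last by lia.
rewrite [trit_of_int (y + z)](@trit_of_int_eqmod _ ((y %% 3)%Z + (z %% 3)%Z)); try lia.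
by case: y3 => ->; case: z3 => ->.
Qed.

Lemma trit_of_intM : {morph trit_of_int : y z / y * z >-> trit_mul y z}.
Proof.
move=> y z; have [q yE y3] := residue_mod3 y; have [q' zE z3] := residue_mod3 z.
rewrite [trit_of_int y](@trit_of_int_eqmod _ (y %% 3)%Z); last by lia.
rewrite [trit_of_int z](@trit_of_int_eqmod _ (z %% 3)%Z); last by lia.
rewrite [trit_of_int (y * z)](@trit_of_int_eqmod _ ((y %% 3)%Z * (z %% 3)%Z)).
  by case: y3 => ->; case: z3 => ->.
rewrite {1}yE {1}zE; move: (y %% 3)%Z (z %% 3)%Z => r r'.
by apply/dvdzP; exists (3 * q * q' + q * r' + r * q'); ring.
Qed.

(** * Cutting lattice vectors into blocks; the minimum of the lattice *)

Definition coord64 (v : 'rV[int]_(32 + 32)) (c : nat) : int := v 0 (inord c : 'I_64).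
Definition block v b := [seq coord64 v (block_idx b c) | c <- iota 0 8].

Lemma sum_blocks (V : nmodType) (F : nat -> V) :
  \sum_(c < 64) F c = \sum_(b <- iota 0 8) \sum_(c <- iota 0 8) F (block_idx b c).
Proof.
rewrite -(big_mkord xpredT F) /index_iota subn0.
transitivity (\sum_(i <- [seq block_idx b c | b <- iota 0 8, c <- iota 0 8]) F i); last first.
  by rewrite big_allpairs_dep.
by apply: perm_big; vm_compute.
Qed.

Lemma ip_test v (f : nat -> nat -> int) (i : 'I_32) a (B : 'M_32) :
  (forall i j : 'I_32, B i j = f i j) ->
  ip v (row_mx (a *: delta_mx 0 i) (a *: (delta_mx 0 i *m B))) =
  a * \sum_(c < 64) coord64 v c * id_row f i c.
Proof.
move=> Bf; rewrite big_distrr; apply: eq_bigr => c _ /=.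
rewrite /coord64 inord_val mulrCA; congr (_ * _); rewrite /id_row.
case: (split_ordP c) => j ->; rewrite ?row_mxEl ?row_mxEr /=.
  by rewrite !mxE eqxx val_eqE; case: eqP.
by rewrite mxE -rowE mxE Bf [(_ - _)%N]addKn.
Qed.

Lemma mat_M_entry (i j : 'I_32) : mat_M i j = M_entry i j.
Proof.
have -> : mat_M = table_mx (tabulate M_entry) by congr table_mx; vm_compute.
by rewrite mxE get_tabulate.
Qed.

Lemma mat_N_entry (i j : 'I_32) : mat_N i j = N_entry i j.
Proof.
have -> : mat_N = table_mx (tabulate N_entry) by congr table_mx; vm_compute.
by rewrite mxE get_tabulate.
Qed.

Lemma lat6_dual v : lat6 v <-> forall w, lat6 w -> (6 %| ip v w)%Z.
Proof. exact: syslat_dual mat_K_KT mat_KT_K v. Qed.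

Lemma lat6_even v : lat6 v -> (12 %| ip v v)%Z.
Proof. exact: (syslat_even _ mat_K_KT). Qed.

Lemma id_row_off b b' s c : (b < 8)%N -> (b' < 8)%N -> (s < 4)%N -> (c < 8)%N -> b' != b ->
  id_row N_entry (4 * b + s) (block_idx b' c) = 0.
Proof.
have : all (fun b => all (fun b' => all (fun s => all (fun c =>
    (b' != b) ==> (id_row N_entry (4 * b + s) (block_idx b' c) == 0%Z))
  (iota 0 8)) (iota 0 4)) (iota 0 8)) (iota 0 8) by vm_compute.
have in_iota n m : (m < n)%N -> m \in iota 0 n by rewrite mem_iota.
move=> weight_check /in_iota b8 /in_iota b'8 /in_iota s4 /in_iota c8 b'b.
by have /allP/(_ _ b8)/allP/(_ _ b'8)/allP/(_ _ s4)/allP/(_ _ c8) := weight_check; rewrite b'b => /eqP.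
Qed.

Lemma odd_absz_dvd (z : int) : odd (absz z) = ~~ (2 %| z)%Z.
Proof. by rewrite dvdzE dvdn2 negbK. Qed.

Lemma even_sum_bit_dot (x h : nat -> int) (l : seq nat) :
  (2 %| \sum_(c <- l) x c * h c)%Z =
  ~~ bit_dot [seq odd (absz (h c)) | c <- l] [seq odd (absz (x c)) | c <- l].
Proof.
rewrite -[LHS]negbK -odd_absz_dvd; congr (~~ _); elim: l => [|c l IHl]; first by rewrite big_nil.
rewrite big_cons /bit_dot /= -/(bit_dot _ _) -IHl -oddM mulnC -abszM.
by move: (_ * _) (\sum_(_ <- _) _) => y z; lia.
Qed.

(** The inner product with [3 (e_i, e_i N)] is divisible by 6, which gives a parity condition. For
    [i = 4b + s] it involves block [b] only, as [N] is monomial along [block_partner]. *)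
Lemma lat6_parity v b : lat6 v -> (b < 8)%N -> even_parity b (block v b).
Proof.
move=> Lv b8.
pose rows b := [seq [seq odd (absz (id_row N_entry (4 * b + s) (block_idx b c))) | c <- iota 0 8]
               | s <- iota 0 4].
have rowsE : nth [::] parity_table b = rows b.
  have : all (fun b => nth [::] parity_table b == rows b) (iota 0 8).
    by vm_compute.
  by move/allP/(_ b); rewrite mem_iota => /(_ b8)/eqP.
rewrite /even_parity /bits_even_parity rowsE all_map; apply/allP => s; rewrite mem_iota => s4.
have i32 : (4 * b + s < 32)%N by lia.
have : (6 %| 3%:Z * \sum_(c < 64) coord64 v c * id_row N_entry (4 * b + s) c)%Z.
  rewrite -(ip_test v (Ordinal i32) _ mat_N_entry); have /lat6_dual := Lv; apply.
  exact: lat6_N.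
rewrite (_ : 6 = 3 * 2) // dvdz_mul2l //.
rewrite (sum_blocks (fun c => coord64 v c * id_row N_entry (4 * b + s) c)).
rewrite (bigD1_seq b) ?mem_iota ?iota_uniq // rpredDr; last first.
  rewrite big1_seq ?rpred0 // => b' /andP[b'b]; rewrite mem_iota => b'8.
  by rewrite big1_seq // => c; rewrite mem_iota => c8; rewrite id_row_off ?mulr0.
move=> even_b.
have := even_sum_bit_dot (fun c => coord64 v (block_idx b c))
  (fun c => id_row N_entry (4 * b + s) (block_idx b c)) (iota 0 8).
by rewrite [LHS]even_b => /esym; rewrite [preim _ _ _]/(~~ bit_dot _ _) /block -map_comp.
Qed.

(** The inner product with [2 (e_i, e_i M)] is divisible by 6, so [v] is orthogonal modulo 3 to row
    [i] of [(1 | M)]. *)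
Lemma lat6_trits v : lat6 v ->
  {in code_gens, forall g, word_dot [seq map trit_of_int (block v b) | b <- iota 0 8] g = trit0}.
Proof.
move=> Lv.
have -> : code_gens = [seq [seq [seq trit_of_int (id_row M_entry i (block_idx b c)) | c <- iota 0 8]
                           | b <- iota 0 8] | i <- iota 0 32].
  by vm_compute.
move=> g /mapP[i]; rewrite mem_iota => i32 -> {g}.
have : (6 %| 2%:Z * \sum_(c < 64) coord64 v c * id_row M_entry i c)%Z.
  rewrite -(ip_test v (Ordinal i32) _ mat_M_entry); have /lat6_dual := Lv; apply.
  exact: lat6_M.
rewrite (_ : 6 = 2 * 3) // dvdz_mul2l // -trit_of_int_eq0 => /eqP <-.
rewrite (sum_blocks (fun c => coord64 v c * id_row M_entry i c)) (big_morph _ trit_of_intD (erefl _)).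
rewrite word_dotE; apply: eq_big_seq => b b8.
rewrite (big_morph _ trit_of_intD (erefl _)) mem_iota in b8 *.
have -> : nth [::] [seq map trit_of_int (block v b) | b <- iota 0 8] b = map trit_of_int (block v b).
  exact: (nth_mkseq [::] (fun b => map trit_of_int (block v b)) b8).
have -> := nth_mkseq [::] (fun b => [seq trit_of_int (id_row M_entry i (block_idx b c)) | c <- iota 0 8]) b8.
rewrite /block -map_comp; elim: (iota 0 8) => [|c s IHs]; first by rewrite big_nil.
by rewrite big_cons trit_of_intM -IHs.
Qed.

Lemma ip_blocks v : ip v v = (\sum_(b <- iota 0 8) seq_norm (block v b))%N%:Z.
Proof.
rewrite (big_morph Posz PoszD (erefl 0%:Z)).
transitivity (\sum_(c < 64) coord64 v c * coord64 v c).
  by apply: eq_bigr => c _; rewrite /coord64 inord_val.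
rewrite (sum_blocks (fun c => coord64 v c * coord64 v c)); apply: eq_bigr => b _.
rewrite /block /seq_norm; elim: (iota 0 8) => [|c s IHs]; first by rewrite big_nil.
rewrite big_cons IHs /= PoszD; congr (_ + _).
by move: (coord64 v _) => z; rewrite -mulnn; nia.
Qed.

Lemma lat6_min v : lat6 v -> ip v v < 36 -> v = 0.
Proof.
move=> Lv v_lt.
(* Norms are divisible by 12, so a norm below 36 is at most 24. *)
have v_le : (\sum_(b <- iota 0 8) seq_norm (block v b) <= 24)%N.
  by have /dvdzP[q] := lat6_even Lv; rewrite ip_blocks in v_lt *; lia.
pose t := [seq map trit_of_int (block v b) | b <- iota 0 8].
have tE b : b \in iota 0 8 -> nth [::] t b = map trit_of_int (block v b).
  by rewrite mem_iota => b8; exact: (nth_mkseq [::] (fun b => map trit_of_int (block v b)) b8).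
have blk8 b : size (block v b) = 8 by rewrite size_map size_iota.
have t_wf : word_ok t.
  rewrite /word_ok size_map size_iota; apply/allP => _ /mapP[b _ ->].
  by rewrite size_map blk8.
have in8 b : b \in iota 0 8 -> (b < 8)%N by rewrite mem_iota.
have par b : b \in iota 0 8 -> even_parity b (block v b) by move/in8; exact: lat6_parity.
have nz0 : nonzero_blocks t = [::].
  apply: no_short_word t_wf (lat6_trits Lv) _.
  rewrite -(leq_pmul2l (isT : 0 < 4)%N); apply: leq_trans v_le.
  rewrite /nonroots /nonzero_blocks -filter_predI !size_filter -!sum1_count.
  rewrite big_mkcond [X in (_ + X)%N]big_mkcond -big_split big_distrr /=.
  rewrite big_seq_cond [X in (_ <= X)%N]big_seq_cond; apply: leq_sum => b /andP[b8 _].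
  rewrite (tE b b8); have [t_eq0|t_neq0] := eqVneq (map trit_of_int (block v b)) zero8.
    by rewrite andbF muln0.
  have := block_cost (in8 _ b8) (blk8 b) (par _ b8) t_neq0.
  by rewrite /= andbT; case: (_ \notin _); move: (seq_norm _) => q /=; lia.
(* Every block now vanishes modulo 3 and is too short to be a nonzero multiple of 3. *)
have blk0 b : b \in iota 0 8 -> seq_norm (block v b) = 0%N.
  move=> b8; apply: (block_zero (in8 _ b8) (blk8 b) (par _ b8)).
    apply/eqP; rewrite -(tE b b8) -[_ == _]negbK; apply/negP => b_nz.
    by have : b \in nonzero_blocks t; [rewrite mem_filter b_nz | rewrite nz0].
  apply: (@leq_ltn_trans 24) => //; apply: leq_trans v_le.
  by rewrite (bigD1_seq b) ?iota_uniq //= leq_addr.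
by apply: ip_eq0; rewrite ip_blocks big1_seq // => b /andP[_ /blk0].
Qed.

(** * Sums of four squares *)

Definition sum4 (n : int) := exists a b c d : int, n = a ^+ 2 + b ^+ 2 + c ^+ 2 + d ^+ 2.

(** Euler's four-square identity. *)
Lemma sum4M m n : sum4 m -> sum4 n -> sum4 (m * n).
Proof.
move=> [a [b [c [d ->]]]] [e [f [g [h ->]]]].
exists (a * e + b * f + c * g + d * h), (a * f - b * e + c * h - d * g),
  (a * g - b * h - c * e + d * f), (a * h + b * g - c * f - d * e).
by ring.
Qed.

Lemma sqr_inj_mod (p x y : nat) : prime p -> (x < p./2.+1)%N -> (y < p./2.+1)%N -> odd p ->
  (x ^ 2 = y ^ 2 %[mod p])%N -> x = y.
Proof.
move=> p_pr; wlog le_yx : x y / (y <= x)%N => [H x_lt y_lt p_odd xy|].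
  by case: (leqP y x) => [|/ltnW] yx; [apply: H|apply/esym/H].
move=> x_lt y_lt p_odd /eqP; rewrite eqn_mod_dvd ?leq_sqr // subn_sqr Euclid_dvdM //.
case/orP=> /dvdnP[q qE]; case: q qE => [|q] qE; try lia.
Qed.

(** Pigeonhole: the residues of [x^2] and those of [-1 - y^2], for [x] and [y] up to [(p - 1) / 2],
    are two sets of [(p + 1) / 2] classes each and must meet. *)
Lemma sum_two_squares_add1 (p : nat) : prime p -> odd p ->
  exists x y, [/\ (x <= p./2)%N, (y <= p./2)%N & (p %| x ^ 2 + y ^ 2 + 1)%N].
Proof.
move=> p_pr p_odd; have p_gt0 := prime_gt0 p_pr.
have p_eq : p = p./2.*2.+1 by rewrite -[LHS]odd_double_half p_odd.
pose f (x : 'I_p./2.+1) : 'I_p := Ordinal (ltn_pmod (x ^ 2) p_gt0).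
(* The term [p * p] vanishes modulo [p] and keeps the subtraction of natural numbers from being
   truncated. *)
pose g (y : 'I_p./2.+1) : 'I_p := Ordinal (ltn_pmod (p * p - y ^ 2 - 1) p_gt0).
have y_le (y : 'I_p./2.+1) : (y ^ 2 + 1 <= p * p)%N by have := ltn_ord y; nia.
have f_inj : injective f.
  by move=> x y /(congr1 val) /= xy; apply/val_inj/(sqr_inj_mod p_pr); rewrite ?ltn_ord.
have g_inj : injective g.
  move=> x y /(congr1 val) /= xy; apply/val_inj/(sqr_inj_mod p_pr); rewrite ?ltn_ord //.
  have := congr1 (fun z => (z + (x ^ 2 + y ^ 2 + 1)) %% p)%N xy; rewrite !modnDml.
  have -> : (p * p - x ^ 2 - 1 + (x ^ 2 + y ^ 2 + 1) = p * p + y ^ 2)%N by have := y_le x; lia.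
  have -> : (p * p - y ^ 2 - 1 + (x ^ 2 + y ^ 2 + 1) = p * p + x ^ 2)%N by have := y_le y; lia.
  by rewrite !modnMDl.
have [z zf zg] : exists2 z, z \in codom f & z \in codom g.
  apply/exists_inP; apply: contraT => /exists_inPn disj.
  have : (#|codom f| + #|codom g| <= p)%N.
    rewrite -[X in (_ <= X)%N](card_ord p) -cardUI.
    rewrite [X in (_ + X)%N](_ : _ = 0%N) ?addn0 ?max_card //.
    by apply: eq_card0 => z; rewrite !inE; apply/negP => /andP[/disj/negP].
  by rewrite !card_codom // !card_ord; lia.
case/codomP: zf => x zx; case/codomP: zg => y; rewrite zx => /(congr1 val) /= xy.
exists x, y; split; [exact: (ltn_ord x) | exact: (ltn_ord y) |].
rewrite /dvdn -addnA -modnDml xy modnDml.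
have -> : (p * p - y ^ 2 - 1 + (y ^ 2 + 1) = p * p)%N by have := y_le y; lia.
by rewrite modnMl.
Qed.

Lemma centered_mod (m : nat) (x : int) : (0 < m)%N ->
  exists y q : int, x = y + m%:Z * q /\ - m%:Z <= 2 * y <= m%:Z.
Proof.
move=> m_gt0; have := divz_eq x m; have := modz_ge0 x (_ : m%:Z != 0); have := ltz_mod x (_ : m%:Z != 0).
move=> /(_ ltac:(lia)) r_lt /(_ ltac:(lia)) r_ge xE.
have [small|big] := lerP (2 * (x %% m)%Z) m.
  by exists (x %% m)%Z, (x %/ m)%Z; split; lia.
by exists ((x %% m)%Z - m%:Z), ((x %/ m)%Z + 1); split; lia.
Qed.

Lemma addr4_le0 (a b c d : int) : 0 <= a -> 0 <= b -> 0 <= c -> 0 <= d -> a + b + c + d <= 0 ->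
  [/\ a <= 0, b <= 0, c <= 0 & d <= 0].
Proof. by split; lia. Qed.

Lemma addr4_eq_max (s a b c d : int) : 4 * a <= s -> 4 * b <= s -> 4 * c <= s -> 4 * d <= s ->
  s <= a + b + c + d ->
  a + b + c + d = s /\ [/\ s <= 4 * a, s <= 4 * b, s <= 4 * c & s <= 4 * d].
Proof. by do 2?split; lia. Qed.

(** Lagrange's descent: reducing the four roots modulo [m] to centered residues [y_i] gives a sum of
    squares [m r] with [r <= m]. The extreme values [r = 0] and [r = m] would make [m] divide [p];
    otherwise [r p] is a sum of four squares. *)
Lemma sum4_descent (p m : nat) : prime p -> (0 < m < p)%N -> sum4 (m * p)%N -> sum4 p.
Proof.
move=> p_pr; elim/ltn_ind: m => m IHm /andP[m_gt0 m_lt] [x1 [x2 [x3 [x4 xE]]]].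
have [m1|m_neq1] := eqVneq m 1%N; first by exists x1, x2, x3, x4; rewrite -xE m1 mul1n.
have [y1 [q1 [x1E y1_le]]] := centered_mod x1 m_gt0.
have [y2 [q2 [x2E y2_le]]] := centered_mod x2 m_gt0.
have [y3 [q3 [x3E y3_le]]] := centered_mod x3 m_gt0.
have [y4 [q4 [x4E y4_le]]] := centered_mod x4 m_gt0.
pose M := m%:Z; have M_gt0 : 0 < M by rewrite /M; lia.
have M_ndvd : ~ exists q, p%:Z = M * q.
  case=> q pq; have : (m %| p)%N.
    by suff : (m%:Z %| p%:Z)%Z by []; apply/dvdzP; exists q; rewrite mulrC.
  by case/primeP: p_pr => _ h /h; rewrite (negPf m_neq1) ltn_eqF.
(* This is the quotient of the sum of the [y_i ^ 2] by [M], written without division. *)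
pose r := p%:Z - (2 * (y1 * q1 + y2 * q2 + y3 * q3 + y4 * q4)
                  + M * (q1 ^+ 2 + q2 ^+ 2 + q3 ^+ 2 + q4 ^+ 2)).
have pE : p%:Z = r + (2 * (y1 * q1 + y2 * q2 + y3 * q3 + y4 * q4)
                  + M * (q1 ^+ 2 + q2 ^+ 2 + q3 ^+ 2 + q4 ^+ 2)) by rewrite /r subrK.
have yE : y1 ^+ 2 + y2 ^+ 2 + y3 ^+ 2 + y4 ^+ 2 = M * r.
  by rewrite /r mulrBr -PoszM xE x1E x2E x3E x4E -/M; ring.
clearbody r.
have sq_le (y : int) : - M <= 2 * y <= M -> 4 * y ^+ 2 <= M ^+ 2.
  clear -M_gt0 => y_le; rewrite -subr_ge0.
  have -> : M ^+ 2 - 4 * y ^+ 2 = (M - 2 * y) * (M + 2 * y) by ring.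
  by apply: mulr_ge0; lia.
have := (sq_le _ y1_le, sq_le _ y2_le, sq_le _ y3_le, sq_le _ y4_le) => -[[[b1 b2] b3] b4].
have sq_ge (y : int) : 0 <= y ^+ 2 by rewrite sqr_ge0.
have := (sq_ge y1, sq_ge y2, sq_ge y3, sq_ge y4) => -[[[c1 c2] c3] c4].
have [r_le0|r_gt0] := lerP r 0.
  have y0 (y : int) : y ^+ 2 <= 0 -> y = 0.
    by move=> y_le; apply/eqP; rewrite -sqrf_eq0 eq_le y_le sqr_ge0.
  have : M * r <= 0 by rewrite pmulr_rle0.
  rewrite -yE => /(addr4_le0 c1 c2 c3 c4)[/y0 y10 /y0 y20 /y0 y30 /y0 y40]; case: M_ndvd.
  exists (q1 ^+ 2 + q2 ^+ 2 + q3 ^+ 2 + q4 ^+ 2); rewrite pE.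
  have -> : r = 0 by apply: (mulfI (lt0r_neq0 M_gt0)); rewrite -yE y10 y20 y30 y40; ring.
  by rewrite y10 y20 y30 y40; ring.
have [r_ge|r_lt] := lerP M r.
  have sumM : M ^+ 2 <= y1 ^+ 2 + y2 ^+ 2 + y3 ^+ 2 + y4 ^+ 2.
    by rewrite yE expr2 ler_pM2l.
  have yM (y : int) : M ^+ 2 <= 4 * y ^+ 2 -> - M <= 2 * y <= M -> exists e, 2 * y = M * e.
    clear -M_gt0 => y_ge y_le; have [y_pos|y_neg] := lerP 0 y; [exists 1|exists (-1)].
      have : 0 <= (2 * y - M) * (2 * y + M).
        have -> : (2 * y - M) * (2 * y + M) = 4 * y ^+ 2 - M ^+ 2 by ring.
        by rewrite subr_ge0.
      by rewrite pmulr_lge0; lia.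
    have : 0 <= (- M - 2 * y) * (M - 2 * y).
      have -> : (- M - 2 * y) * (M - 2 * y) = 4 * y ^+ 2 - M ^+ 2 by ring.
      by rewrite subr_ge0.
    by rewrite pmulr_lge0; lia.
  have [sumE [d1 d2 d3 d4]] := addr4_eq_max b1 b2 b3 b4 sumM.
  have [e1 e1E] := yM y1 d1 y1_le; have [e2 e2E] := yM y2 d2 y2_le.
  have [e3 e3E] := yM y3 d3 y3_le; have [e4 e4E] := yM y4 d4 y4_le.
  case: M_ndvd.
  exists (1 + (e1 * q1 + e2 * q2 + e3 * q3 + e4 * q4) + (q1 ^+ 2 + q2 ^+ 2 + q3 ^+ 2 + q4 ^+ 2)).
  have rM : r = M by apply: (mulfI (lt0r_neq0 M_gt0)); rewrite -yE -expr2.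
  rewrite pE rM !mulrDr !mulrA e1E e2E e3E e4E; ring.
have rp : sum4 (r * p%:Z).
  (* Euler's identity applied to the [x_i] and the [y_i], with [M] divided out. Multiplied by
     [M ^ 2], [r] occurs only as [M r] and can be replaced by the sum of the [y_i ^ 2]. *)
  exists (r + (q1 * y1 + q2 * y2 + q3 * y3 + q4 * y4)), (q1 * y2 - q2 * y1 + q3 * y4 - q4 * y3),
    (q1 * y3 - q2 * y4 - q3 * y1 + q4 * y2), (q1 * y4 + q2 * y3 - q3 * y2 - q4 * y1).
  have M2 : M ^+ 2 != 0 by rewrite expf_neq0 // lt0r_neq0.
  apply: (mulfI M2); rewrite pE.
  have -> : M ^+ 2 * (r * (r + (2 * (y1 * q1 + y2 * q2 + y3 * q3 + y4 * q4) +
       M * (q1 ^+ 2 + q2 ^+ 2 + q3 ^+ 2 + q4 ^+ 2)))) =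
    (M * r) * (M * r + (2 * M * (y1 * q1 + y2 * q2 + y3 * q3 + y4 * q4) +
       M ^+ 2 * (q1 ^+ 2 + q2 ^+ 2 + q3 ^+ 2 + q4 ^+ 2))) by ring.
  have -> : M ^+ 2 * ((r + (q1 * y1 + q2 * y2 + q3 * y3 + q4 * y4)) ^+ 2 +
      (q1 * y2 - q2 * y1 + q3 * y4 - q4 * y3) ^+ 2 + (q1 * y3 - q2 * y4 - q3 * y1 + q4 * y2) ^+ 2 +
      (q1 * y4 + q2 * y3 - q3 * y2 - q4 * y1) ^+ 2) =
    (M * r + M * (q1 * y1 + q2 * y2 + q3 * y3 + q4 * y4)) ^+ 2 + M ^+ 2 *
      ((q1 * y2 - q2 * y1 + q3 * y4 - q4 * y3) ^+ 2 + (q1 * y3 - q2 * y4 - q3 * y1 + q4 * y2) ^+ 2 +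
      (q1 * y4 + q2 * y3 - q3 * y2 - q4 * y1) ^+ 2) by ring.
  by rewrite -yE; ring.
have r_lt' : r < m%:Z by [].
have r_bound : (absz r < m)%N by clear -r_gt0 r_lt'; lia.
apply: (IHm (absz r)) => //; first by rewrite (ltn_trans r_bound) // absz_gt0 lt0r_neq0.
by rewrite PoszM gtz0_abs.
Qed.

Theorem four_squares (n : nat) : sum4 n.
Proof.
have sum4_0 : sum4 0 by exists 0, 0, 0, 0.
have sum4_1 : sum4 1 by exists 1, 0, 0, 0.
have sum4_prime p : prime p -> sum4 p.
  move=> p_pr; have [p2|p_odd] := even_prime p_pr; first by exists 1, 1, 0, 0; rewrite p2.
  have [x [y [x_le y_le /dvdnP[m mE]]]] := sum_two_squares_add1 p_pr p_odd.
  have p_half := odd_double_half p; rewrite p_odd in p_half.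
  apply: (@sum4_descent p m) => //; first by have := prime_gt1 p_pr; nia.
  by exists x, y, 1, 0; rewrite -mE -!mulnn !PoszD !PoszM; ring.
elim/ltn_ind: n => n IHn; have [n_le1|n_gt1] := leqP n 1.
  by case: n n_le1 {IHn} => [|[]].
have := IHn (n %/ pdiv n)%N (ltn_Pdiv (prime_gt1 (pdiv_prime n_gt1)) (ltnW n_gt1)).
move/(sum4M (sum4_prime _ (pdiv_prime n_gt1))); rewrite -PoszM mulnC divnK //.
exact: pdiv_dvd.
Qed.

(** * Frames for [k >= 3] *)

Section Frames.
Variables (x1 x2 x3 x4 a b c : int).
Hypothesis a_eq : a = b + 3 * c.

Let X : 'M[int]_32 := x1 *: mat_I + x2 *: mat_J + x3 *: (mat_I *m mat_J).
Let n3 := x1 ^+ 2 + x2 ^+ 2 + x3 ^+ 2.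

Let X_tr : X^T = - X.
Proof.
rewrite /X !linearD !linearZ /= trmx_mul mat_I_tr mat_J_tr mulmxN mulNmx opprK.
by rewrite -[mat_J *m mat_I]opprK -mat_I_J !scalerN ?opprD.
Qed.

Let IIJ : mat_I *m (mat_I *m mat_J) = - mat_J.
Proof. by rewrite mulmxA mat_I_sqr mul_scalar_mx scaleN1r. Qed.
Let IJI : mat_I *m mat_J *m mat_I = mat_J.
Proof. by rewrite mat_I_J mulNmx -mulmxA mat_I_sqr mul_mx_scalar scaleN1r opprK. Qed.
Let JIJ : mat_J *m (mat_I *m mat_J) = mat_I.
Proof. by rewrite mat_I_J mulmxN mulmxA mat_J_sqr mul_scalar_mx scaleN1r opprK. Qed.
Let IJJ : mat_I *m mat_J *m mat_J = - mat_I.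
Proof. by rewrite -mulmxA mat_J_sqr mul_mx_scalar scaleN1r. Qed.
Let IJIJ : mat_I *m mat_J *m (mat_I *m mat_J) = (-1)%:M.
Proof. by rewrite mulmxA IJI mat_J_sqr. Qed.
Let JI : mat_J *m mat_I = - (mat_I *m mat_J). Proof. by rewrite mat_I_J opprK. Qed.

Let X_sqr : X *m X = (- n3)%:M.
Proof.
rewrite /X !mulmxDl !mulmxDr -!scalemxAl -!scalemxAr mat_I_sqr mat_J_sqr IIJ IJI JIJ IJJ IJIJ JI.
move: (mat_I *m mat_J) => IJ; apply/matrixP => i j; rewrite !mxE /n3.
by case: (i == j); rewrite ?mulr1n ?mulr0n; ring.
Qed.

Let M_X : mat_M *m X = X *m mat_M.
Proof.
have M_IJ : mat_M *m (mat_I *m mat_J) = mat_I *m mat_J *m mat_M.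
    by rewrite mulmxA mat_M_I -mulmxA mat_M_J mulmxA.
by rewrite /X !mulmxDl !mulmxDr -!scalemxAl -!scalemxAr mat_M_I mat_M_J M_IJ.
Qed.

Let P := a%:M + 3%:Z *: X.
Let Q := b *: mat_M + (3 * x4)%:M.

Let P_tr : P^T = a%:M - 3%:Z *: X.
Proof. by rewrite /P linearD linearZ /= tr_scalar_mx X_tr scalerN. Qed.

Let Q_tr : Q^T = (3 * x4)%:M - b *: mat_M.
Proof. by rewrite /Q linearD linearZ /= tr_scalar_mx mat_M_tr scalerN addrC. Qed.

Let PPT : P *m P^T = (a ^+ 2 + 9 * n3)%:M /\ P^T *m P = (a ^+ 2 + 9 * n3)%:M.
Proof.
rewrite P_tr /P !mulmxDl !mulmxDr !mulNmx !mulmxN !mul_mx_scalar !mul_scalar_mx.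
rewrite -!scalemxAl -!scalemxAr X_sqr.
by split; apply/matrixP => i j; rewrite !mxE; move: (X i j) => Xij;
  case: (i == j); rewrite ?mulr1n ?mulr0n; ring.
Qed.

Let QQT : Q *m Q^T = (11 * b ^+ 2 + 9 * x4 ^+ 2)%:M /\ Q^T *m Q = (11 * b ^+ 2 + 9 * x4 ^+ 2)%:M.
Proof.
rewrite Q_tr /Q !mulmxDl !mulmxDr !mulNmx !mulmxN !mul_mx_scalar !mul_scalar_mx.
rewrite -!scalemxAl -!scalemxAr mat_M_sqr.
by split; apply/matrixP => i j; rewrite !mxE; move: (mat_M i j) => Mij;
  case: (i == j); rewrite ?mulr1n ?mulr0n; ring.
Qed.

Let PQ : P *m Q = Q *m P.
Proof.
rewrite /P /Q !mulmxDl !mulmxDr !mul_mx_scalar !mul_scalar_mx -!scalemxAl -!scalemxAr M_X.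
by move: (X *m mat_M) => Y; apply/matrixP => i j; rewrite !mxE; ring.
Qed.

Definition frame_mx : 'M[int]_(32 + 32) := 2%:Z *: block_mx P Q (- Q^T) P^T.

Let k4 := 4 * (a ^+ 2 + 11 * b ^+ 2 + 9 * (n3 + x4 ^+ 2)).

(** The off-diagonal blocks cancel because [P] and [Q] commute, and the products of each with its
    transpose are scalar. *)
Lemma frame_mxP : frame_mx *m frame_mx^T = k4%:M.
Proof.
have QTPT : Q^T *m P^T = P^T *m Q^T by rewrite -!trmx_mul PQ.
rewrite /frame_mx [(_ *: _)^T]linearZ /= tr_block_mx !trmxK -scalemxAl -scalemxAr scalerA.
rewrite mulmx_block PPT.1 QQT.1 ![(- Q^T)^T]linearN /= !trmxK !mulmxN !mulNmx PQ addNr QTPT.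
rewrite addNr opprK PPT.2 QQT.2 -!raddfD /= addrC -scalar_mx_block.
by rewrite scale_scalar_mx; congr (_%:M); rewrite /k4; ring.
Qed.

(** By [lat6_double] the right half need only be the left half times [M] modulo 3. For the upper
    rows this is [a = b] modulo 3; the lower ones also use that [M^2 = -11] is 1 modulo 3. *)
Lemma lat6_frame_mx i : lat6 (row i frame_mx).
Proof.
have upper : Q = P *m mat_M + 3%:Z *: (x4%:M - c *: mat_M - X *m mat_M).
  rewrite /P /Q mulmxDl mul_scalar_mx -scalemxAl a_eq; move: (X *m mat_M) => Y.
  by apply/matrixP => j l; rewrite !mxE; case: (j == l); rewrite ?mulr1n ?mulr0n; ring.
have lower : P^T = - Q^T *m mat_M + 3%:Z *: ((4 * b + c)%:M - X + x4 *: mat_M).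
  rewrite P_tr Q_tr mulNmx mulmxBl mul_scalar_mx -scalemxAl mat_M_sqr a_eq.
  by apply/matrixP => j l; rewrite !mxE; case: (j == l); rewrite ?mulr1n ?mulr0n; ring.
have row_comb (Y Z : 'M[int]_32) j : row j (Y *m mat_M + 3%:Z *: Z) = row j Y *m mat_M + 3%:Z *: row j Z.
  by rewrite -row_mul; apply/rowP => l; rewrite !mxE.
rewrite /frame_mx linearZ /=; case: (split_ordP i) => j ->.
  rewrite block_mxEv rowKu row_row_mx upper row_comb scale_row_mx.
  exact: lat6_double.
rewrite block_mxEv rowKd row_row_mx lower row_comb scale_row_mx.
exact: lat6_double.
Qed.

End Frames.

Definition short_vec_l : seq int :=
  [:: 1; 1; -1; 0; 0; 1; -1; 0; 0; 0; 0; 0; 0; 1; 0; 0;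
      2; 0; 0; 0; -1; 0; 0; 0; 0; 1; 0; -1; 0; 0; 0; -1]%Z.
Definition short_vec_r : seq int :=
  [:: 0; -1; -1; 0; 0; 0; 0; 0; 1; 0; 1; -1; 1; 0; 0; 0;
      0; -1; 1; -1; 0; -1; 0; -1; 1; -1; 1; 0; 0; 2; 0; 2]%Z.
Definition short_vec : 'rV[int]_(32 + 32) := row_mx (seq_row 32 short_vec_l) (seq_row 32 short_vec_r).

Lemma lat6_short_vec : lat6 short_vec.
Proof. by rewrite /lat6 mat_K_table; apply: syslat_seq_row; vm_compute. Qed.

Lemma ip_short_vec : ip short_vec short_vec = 36.
Proof. by rewrite ip_seq_row; vm_compute. Qed.

Theorem extremal_of_frame (x1 x2 x3 x4 a b c : int) (k : nat) : (0 < k)%N -> a = b + 3 * c ->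
  a ^+ 2 + 11 * b ^+ 2 + 9 * (x1 ^+ 2 + x2 ^+ 2 + x3 ^+ 2 + x4 ^+ 2) = (3 * k)%N%:Z ->
  exists C : {set 'rV['Z_(k.*2)]_64}, extremal_typeII C.
Proof.
move=> k_gt0 a_eq normE.
apply: (@frame_code k 6 lat6 (frame_mx x1 x2 x3 x4 a b)) => //.
- exact: lat6_dual.
- exact: lat6_even.
- exact: (lat6_frame_mx _ _ _ _ a_eq).
- rewrite frame_mxP; congr (_%:M); apply: etrans (_ : 4 * (3 * k)%N%:Z = _); last by lia.
  by rewrite -normE.
- by move=> v Lv v_lt; exists 0; rewrite mul0mx; apply: lat6_min.
exists short_vec; split; [exact: lat6_short_vec | exact: ip_short_vec |].
(* The frame matrix is even, whereas the first coordinate of [short_vec] is 1. *)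
move=> y /(congr1 (fun v : 'rV_(32 + 32) => v 0 (@lshift 32 32 ord0))).
rewrite row_mxEl mxE /frame_mx -scalemxAr mxE.
by move: ((y *m _) _ _) => z; rewrite /=; lia.
Qed.

Theorem extremal_ge3 (k : nat) : (2 < k)%N -> exists C : {set 'rV['Z_(k.*2)]_64}, extremal_typeII C.
Proof.
move=> k_gt2; have k_gt0 : (0 < k)%N by lia.
have four n : exists x1 x2 x3 x4 : int, n%:Z = x1 ^+ 2 + x2 ^+ 2 + x3 ^+ 2 + x4 ^+ 2.
  exact: four_squares.
(* The three pairs [(a, b)] contribute 0, 12 or 15 to [3k], so the four squares must sum to [k / 3],
   [(k - 4) / 3] or [(k - 5) / 3]. For [k >= 3] these are natural numbers. *)
have [x1 [x2 [x3 [x4 xE]]]] := four ((k - (k %% 3 + (k %% 3 != 0) * 3)) %/ 3)%N.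
have : [|| k %% 3 == 0, k %% 3 == 1 | k %% 3 == 2]%N by lia.
case/or3P=> /eqP k3; rewrite k3 in xE.
- apply: (@extremal_of_frame x1 x2 x3 x4 0 0 0) => //; rewrite -xE; lia.
- apply: (@extremal_of_frame x1 x2 x3 x4 1 1 0) => //; rewrite -xE; lia.
apply: (@extremal_of_frame x1 x2 x3 x4 (-2) 1 (-1)) => //; rewrite -xE; lia.
Qed.

(** * Binary and quaternary codes *)

Definition bits n (p : 'rV[int]_n) := [seq odd (absz (p ord0 i)) | i <- enum 'I_n].

Lemma size_bits n (p : 'rV_n) : size (bits p) = n.
Proof. by rewrite size_map size_enum_ord. Qed.

Lemma nth_bits n (p : 'rV_n) (i : 'I_n) : nth false (bits p) i = odd (absz (p ord0 i)).
Proof. by rewrite (nth_map i) ?size_enum_ord // nth_ord_enum. Qed.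

Lemma bits_norm n (p : 'rV_n) : (count id (bits p))%:Z <= ip p p.
Proof.
rewrite count_map -sum1_count (big_morph Posz PoszD (erefl 0%:Z)) big_enum_cond big_mkcond /=.
apply: ler_sum => i _; case: ifP => [pi_odd|_]; last by rewrite -expr2 sqr_ge0.
have : p ord0 i != 0 by apply: contraTneq pi_odd => ->.
by move: (p ord0 i) => z; nia.
Qed.

Lemma bits_even n (p : 'rV_n) : count id (bits p) = 0%N -> exists y, p = 2%:Z *: y.
Proof.
move=> p0; apply/dvd_mxP/forallP => i; apply: contraT; rewrite -odd_absz_dvd => pi.
have : has id (bits p).
  by apply/hasP; exists true => //; rewrite -pi -nth_bits mem_nth // size_bits.
by rewrite has_count p0.
Qed.

Lemma bits_eq n (p q : 'rV[int]_n) z : p = q + 2%:Z *: z -> bits p = bits q.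
Proof.
move=> ->; apply: eq_map => i; rewrite !mxE; move: (q _ _) (z _ _) => a b.
by lia.
Qed.

Lemma bits_double n (y : 'rV_n) : count id (bits (2%:Z *: y)) = 0%N.
Proof.
apply/eqP; rewrite -leqn0 leqNgt -has_count; apply/hasPn => _ /mapP[i _ ->].
by rewrite mxE abszM oddM.
Qed.

Definition bxor := map2 addb.
Definition bit_comb n (e : seq bool) (rows : seq (seq bool)) := foldr bxor (nseq n false) (mask e rows).
Definition int_of_bool (b : bool) : int := if b then 1%Z else 0%Z.
Definition bit_mx r c (rows : seq (seq bool)) : 'M[int]_(r, c) :=
  \matrix_(i, j) int_of_bool (nth false (nth [::] rows i) j).

Definition shape_ok r c (rows : seq (seq bool)) := (size rows == r) && all (fun s => size s == c) rows.

Lemma size_bit_comb c e rows : all (fun s => size s == c) rows -> size (bit_comb c e rows) = c.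
Proof.
rewrite /bit_comb; elim: rows e => [|r rows IHr] [|[] e] //=; rewrite ?size_nseq //.
  by case/andP=> /eqP rc /(IHr e) sz; rewrite size_map2 rc // sz.
by case/andP=> _ /(IHr e).
Qed.

Lemma bits_mulmx r c (p : 'rV[int]_r) rows : shape_ok r c rows ->
  bits (p *m bit_mx r c rows) = bit_comb c (bits p) rows.
Proof.
case/andP=> /eqP rows_r rows_c; apply: (@eq_from_nth _ false).
  by rewrite size_bits size_bit_comb.
move=> j; rewrite size_bits => j_lt; rewrite (nth_bits _ (Ordinal j_lt)) mxE.
pose l := [seq p ord0 i | i <- enum 'I_r].
have l_r : size l = r by rewrite size_map size_enum_ord.
have -> : bits p = [seq odd (absz z) | z <- l] by rewrite -map_comp.
transitivity (odd (absz (\sum_(x <- zip l rows) x.1 * int_of_bool (nth false x.2 j)))).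
  congr (odd (absz _)); rewrite (big_nth (0, [::])) size_zip l_r rows_r minnn big_mkord.
  apply: eq_bigr => i _; rewrite nth_zip ?l_r // mxE.
  by rewrite (nth_map i) ?size_enum_ord // nth_ord_enum.
have {l_r rows_r} : size l = size rows by rewrite l_r.
elim: rows rows_c l => [|s rows IHr] rows_c [|x l] //=.
  by rewrite big_nil /bit_comb /= nth_nseq if_same.
move=> [l_rows]; case/andP: rows_c => /eqP sc rows_c; rewrite big_cons.
set y := \sum_(y <- _) _.
have -> : odd (absz (x * int_of_bool (nth false s j) + y)) =
    (odd (absz x) && nth false s j) (+) odd (absz y).
  by move: y => y; case: (nth false s j); rewrite /int_of_bool; lia.
rewrite /y IHr // /bit_comb /=; case: (odd _) => //=.
by rewrite nth_map2 ?sc // size_bit_comb.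
Qed.

(* [acc] is the sum of [w] rows already chosen; at most [d] more are added. *)
Fixpoint weight_check (rows : seq (seq bool)) (d bound w : nat) (acc : seq bool) : bool :=
  match d, rows with
  | d'.+1, r :: rows' => weight_check rows' d bound w acc &&
      (let acc' := bxor r acc in (bound < w.+1 + count id acc')%N && weight_check rows' d' bound w.+1 acc')
  | _, _ => true
  end.

Lemma weight_checkP n rows d bound w acc e : weight_check rows d bound w acc -> size acc = n ->
  all (fun s => size s == n) rows -> size e = size rows -> (0 < count id e <= d)%N ->
  (bound < w + count id e + count id (foldr bxor acc (mask e rows)))%N.
Proof.
have bxorA (x y z : seq bool) : bxor x (bxor y z) = bxor y (bxor x z).
  elim: x y z => [|a x IHx] [|b y] [|c z] //=.
  by rewrite /bxor /= -/(bxor _ _) IHx !addbA (addbC a).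
have foldA s acc' l : foldr bxor (bxor s acc') l = bxor s (foldr bxor acc' l).
  by elim: l => //= x l ->.
elim: rows d w acc e => [|r rows IHr] [|d] w acc [|b e] //=; rewrite ?andbF //.
  by move=> _ _ _ _ /andP[]; case: (_ + _)%N.
move=> /andP[chk0 /andP[chk_r chk1]] acc_n /andP[/eqP r_n rows_n] [e_rows].
case: b => /= e_pos; last by apply: (IHr d.+1).
rewrite addnA addn1 -foldA; case: (posnP (count id e)) => [e0|e_gt0].
  rewrite e0 addn0; suff -> : mask e rows = [::] by [].
  by apply/size0nil; rewrite size_mask.
by apply: (IHr d) => //; [rewrite size_map2 ?r_n | rewrite e_gt0].
Qed.

Lemma min_weight_mulmx r c rows d bound (p : 'rV[int]_r) :
    shape_ok r c rows -> weight_check rows d bound 0 (nseq c false) -> (0 < count id (bits p) <= d)%N ->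
  (bound < count id (bits p) + count id (bits (p *m bit_mx r c rows)))%N.
Proof.
move=> sh ck p_wt; rewrite bits_mulmx // -[X in (_ < X + _)%N]add0n.
case/andP: sh => /eqP sz rows_c.
by apply: (weight_checkP ck) rows_c _ p_wt; rewrite ?size_nseq ?size_bits ?sz.
Qed.

(** * The case [k = 1]: a bordered back-circulant code *)

Definition bin_cyclic : seq bool := [seq b == 1%N | b <-
  [:: 1; 0; 0; 1; 1; 1; 1; 1; 0; 1; 1; 0; 0; 1; 0; 0;
      1; 1; 1; 0; 1; 0; 1; 1; 0; 1; 1; 0; 1; 0; 0]%N].
(** In the last row and column [i != j] yields a border of ones with a zero corner. *)
Definition bin_rows : seq (seq bool) := Eval vm_compute in
  [seq [seq if (i < 31)%N && (j < 31)%N then nth false bin_cyclic ((i + j) %% 31)%N else i != j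
       | j <- iota 0 32] | i <- iota 0 32].
Definition bin_mx : 'M[int]_32 := bit_mx 32 32 bin_rows.
Definition bin_table := Eval vm_compute in [seq [seq int_of_bool b | b <- r] | r <- bin_rows].
(** An upper triangular [S] for the evenness criterion. The matrix is symmetric, so its square is
    its Gram matrix; the diagonal is divided by 4 because it is counted twice in [S + S^T]. *)
Definition bin_half_gram := Eval vm_compute in
  let g := table_mul bin_table bin_table in
  tabulate (fun i j => if (i < j)%N then (get g i j %/ 2)%Z
                       else if i == j then ((1 + get g i j)%R %/ 4)%Z else 0).

Lemma bin_rows_shape : shape_ok 32 32 bin_rows. Proof. by vm_compute. Qed.

Lemma bin_mxE : bin_mx = table_mx bin_table.
Proof.
apply/matrixP => i j; rewrite !mxE /get.
have -> : bin_table = [seq [seq int_of_bool b | b <- r] | r <- bin_rows] by vm_compute.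
case/andP: bin_rows_shape => /eqP sz /all_nthP h; rewrite (nth_map [::]) ?sz // (nth_map false) //.
by rewrite (eqP (h _ _ _)) ?sz.
Qed.

Lemma bin_mx_tr : bin_mx^T = bin_mx.
Proof. by rewrite bin_mxE table_mx_tr; congr table_mx; vm_compute. Qed.

Lemma bin_mx_gram : 1%:M + bin_mx *m bin_mx^T = 2%:Z *: (table_mx bin_half_gram + (table_mx bin_half_gram)^T).
Proof.
rewrite bin_mx_tr bin_mxE table_mxM //; apply/matrixP => i j; rewrite !mxE.
have : all (fun i => all (fun j =>
    intZmod.addz (if i == j then 1%Z else 0%Z) (get (table_mul bin_table bin_table) i j)
    == intRing.mulz 2%Z (intZmod.addz (get bin_half_gram i j) (get bin_half_gram j i))) (iota 0 32)) (iota 0 32).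
  by vm_compute.
move/allP/(_ i); rewrite mem_iota ltn_ord => /(_ isT)/allP/(_ j); rewrite mem_iota ltn_ord => /(_ isT)/eqP.
by rewrite val_eqE; case: (i == j).
Qed.

Lemma bin_mx_gram_tr :
  1%:M + bin_mx^T *m bin_mx = 2%:Z *: (table_mx bin_half_gram + (table_mx bin_half_gram)^T).
Proof. by rewrite -bin_mx_gram bin_mx_tr. Qed.

(* The code is systematic on both halves, so a word of weight at most 8 has weight at most 4 on
   one of two information sets. *)
Lemma bin_mx_weight (p q : 'rV[int]_32) : bits q = bits (p *m bin_mx) -> (0 < count id (bits p) <= 4)%N ->
  (8 < count id (bits p) + count id (bits q))%N.
Proof.
move=> qE p_wt; rewrite qE; apply: min_weight_mulmx bin_rows_shape _ p_wt.
by vm_compute.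
Qed.

Lemma bin_lattice_min (v : 'rV[int]_(32 + 32)) : syslat 2 bin_mx v -> ip v v < 12 -> exists y, v = 2%:Z *: y.
Proof.
move=> Lv v_lt; have [z vE] := syslatP _ _ _ Lv.
have v_le : ip v v <= 8 by have /dvdzP[q qE] := syslat_even (isT : ~~ odd 2) bin_mx_gram Lv; lia.
move: vE v_le; set p := lsubmx v; set q := _ + _ => vE; rewrite vE ip_row_mx => v_le.
have pq : (count id (bits p) + count id (bits q) <= 8)%N.
  by have := bits_norm p; have := bits_norm q; lia.
have qE : bits q = bits (p *m bin_mx) by apply: bits_eq.
(* The square of [bin_mx] is -1 modulo 2, so the two halves play symmetric roles; one of them has at
   most four odd entries. *)
have pE : bits p = bits (q *m bin_mx).
  apply: (@bits_eq _ _ _ (p - p *m (table_mx bin_half_gram + (table_mx bin_half_gram)^T) - z *m bin_mx)).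
  rewrite /q mulmxDl -mulmxA -scalemxAl.
  have -> : bin_mx *m bin_mx = 2%:Z *: (table_mx bin_half_gram + (table_mx bin_half_gram)^T) - 1%:M.
    by rewrite -bin_mx_gram bin_mx_tr addrC addKr.
  rewrite mulmxBr mulmx1 -scalemxAr; move: (p *m _) (z *m _) => X Y.
  by apply/rowP => j; rewrite !mxE; ring.
have [p0|p_gt0] := posnP (count id (bits p)).
  have q0 : count id (bits q) = 0%N.
    by have [y py] := bits_even p0; rewrite qE py -scalemxAl bits_double.
  have [y ->] := bits_even p0; have [y' ->] := bits_even q0.
  by exists (row_mx y y'); rewrite scale_row_mx.
have [p_le4|p_gt4] := leqP (count id (bits p)) 4.
  by have := bin_mx_weight qE; rewrite p_gt0 p_le4 ltnNge pq => /(_ isT).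
have q_gt0 : (0 < count id (bits q))%N.
  rewrite lt0n; apply: contraTneq p_gt0 => q0; have [y qy] := bits_even q0.
  by rewrite pE qy -scalemxAl bits_double.
have q_le4 : (count id (bits q) <= 4)%N by lia.
by have := bin_mx_weight pE; rewrite q_gt0 q_le4 addnC ltnNge pq => /(_ isT).
Qed.

(** The missing entries are read as the default 0: the word is the sum modulo 2 of the generators of
    index 0 and 3, of weight 12. *)
Definition bin_short_l : seq int := [:: 1; 0; 0; 1]%Z.
Definition bin_short_r : seq int :=
  [:: 0; 1; 1; 0; 0; 1; 0; 0; 0; 1; 0; 0; 0; 0; 1; 1;
      1; 0; 1; 1; 0; 0; 0; 0; 0; 0; 1; 0; 0; 0; 0; 0]%Z.

Theorem extremal_1 : exists C : {set 'rV['Z_(1.*2)]_64}, extremal_typeII C.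
Proof.
apply: (@frame_code 1 2 (syslat 2 bin_mx) 2%:M) => //.
- exact: (syslat_dual bin_mx_gram bin_mx_gram_tr).
- exact: (syslat_even _ bin_mx_gram).
- move=> i; apply/(syslat_dual bin_mx_gram bin_mx_gram_tr) => w _.
  by rewrite ipC -ip_row tr_scalar_mx mul_mx_scalar mxE dvdz_mulr.
- by rewrite tr_scalar_mx -scalar_mxM.
- by move=> v Lv /(bin_lattice_min Lv)[y ->]; exists y; rewrite mul_mx_scalar.
exists (row_mx (seq_row 32 bin_short_l) (seq_row 32 bin_short_r)); split.
- by rewrite bin_mxE; apply: syslat_seq_row; vm_compute.
- by rewrite ip_seq_row; vm_compute.
move=> y /(congr1 (fun v : 'rV_(32 + 32) => v 0 (@lshift 32 32 ord0))).
rewrite row_mxEl mul_mx_scalar !mxE.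
by move: (y _ _) => z; rewrite /=; lia.
Qed.

(** * Lattices from Z_4-codes with a given residue code *)

Section QuaternaryLift.
Variables (r c : nat) (A : 'M[int]_(r, c)) (F S : 'M[int]_r).

Definition lift_gen : 'M[int]_(r, r + c) := row_mx (1%:M + 2%:Z *: F) A.
Let G := lift_gen.
Hypothesis GGT : G *m G^T = 4%:Z *: (S + S^T).
Hypothesis ones : exists h, const_mx 1 *m A = const_mx 1 + 2%:Z *: h :> 'rV_c.

(* Construction A for the Z_4-code spanned by the rows of [G] and twice the words orthogonal
   to [G] modulo 2. *)
Definition quatlat (v : 'rV[int]_(r + c)) :=
  [forall i, (4 %| (v *m G^T) ord0 i)%Z] && [forall j, (2 %| (rsubmx v - lsubmx v *m A) ord0 j)%Z].

Let mulGT (p : 'rV[int]_r) (f : 'rV_c) : row_mx p f *m G^T = p + 2%:Z *: (p *m F^T) + f *m A^T.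
Proof. by rewrite tr_row_mx mul_row_col linearD linearZ /= trmx1 mulmxDr mulmx1 -scalemxAr. Qed.

Let quatlat_gen p t s : t *m G^T = 2%:Z *: s -> quatlat (p *m G + 2%:Z *: t).
Proof.
move=> tG; apply/andP; split; apply/dvd_mxP.
  exists (p *m (S + S^T) + s).
  by rewrite mulmxDl -mulmxA GGT -scalemxAl tG -scalemxAr scalerA scalerDr.
exists (rsubmx t - (p *m F + lsubmx t) *m A).
rewrite /G /lift_gen mul_mx_row -{1 2}[t]hsubmxK scale_row_mx add_row_mx row_mxKl row_mxKr.
rewrite mulmxDr mulmx1 !mulmxDl -!scalemxAr -!scalemxAl.
by move: (_ *m A) (_ *m A) (_ *m A) (rsubmx t) => X Y Z W; apply/rowP => j; rewrite !mxE; ring.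
Qed.

Let quatlatP v : quatlat v ->
  exists p t s, v = p *m G + 2%:Z *: t /\ t *m G^T = 2%:Z *: s.
Proof.
case/andP=> /dvd_mxP[y vG] /dvd_mxP[z vz].
pose p := lsubmx v; pose t := row_mx (- (p *m F)) z.
have vE : v = p *m G + 2%:Z *: t.
  rewrite /G /lift_gen mul_mx_row scale_row_mx add_row_mx -[LHS]hsubmxK; congr row_mx.
    by rewrite mulmxDr mulmx1 -scalemxAr scalerN addrK.
  by rewrite -vz addrC subrK.
exists p, t, (y - p *m (S + S^T)); split=> //.
apply: (@scalemx_intI _ _ 2) => //; rewrite scalemxAl scalerA scalerBr scalemxAr -GGT -vG {1}vE.
by rewrite mulmxDl -mulmxA addrC addKr -scalemxAl.
Qed.

Let ip_gen p t s p' t' s' : t *m G^T = 2%:Z *: s -> t' *m G^T = 2%:Z *: s' ->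
  ip (p *m G + 2%:Z *: t) (p' *m G + 2%:Z *: t') =
  4%:Z * (ip p (p' *m (S + S^T)) + ip p s' + ip s p' + ip t t').
Proof.
move=> tG t'G; rewrite !ipDl !ipDr !ipZl !ipZr (ipC t) !(ip_mulmx _ G) tG t'G.
by rewrite -mulmxA GGT -scalemxAr !ipZr (ipC s); ring.
Qed.

(** Modulo 2 the norm of [t] is its inner product with the all-ones vector, which by [ones] lies in
    the residue code. *)
Let dual_even t s : t *m G^T = 2%:Z *: s -> (2 %| ip t t)%Z.
Proof.
have [h hE] := ones => tG.
have [h' h'E] : exists h', const_mx 1 *m G = const_mx 1 + 2%:Z *: h' :> 'rV_(r + c).
  exists (row_mx (const_mx 1 *m F) h); rewrite /G /lift_gen mul_mx_row hE mulmxDr mulmx1 -scalemxAr.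
  by rewrite scale_row_mx -row_mx_const add_row_mx.
have -> : ip t t = (ip t t - ip t (const_mx 1)) + 2%:Z * (ip s (const_mx 1) - ip t h').
  have -> : ip t (const_mx 1) = ip t (const_mx 1 *m G) - 2%:Z * ip t h'.
    by rewrite h'E ipDr ipZr addrK.
  by rewrite (ipC t (_ *m G)) ip_mulmx tG ipZr (ipC _ s); ring.
rewrite rpredD ?dvdz_mulr // /ip -sumrB rpred_sum // => i _; rewrite mxE.
move: (t _ _) => x; have [q [->|->]] : exists q, x = 2%:Z * q \/ x = 2%:Z * q + 1.
  by exists (x %/ 2)%Z; lia.
- by apply/dvdzP; exists (2%:Z * q ^+ 2 - q); ring.
by apply/dvdzP; exists (2%:Z * q ^+ 2 + q); ring.
Qed.

(** Conversely, the rows of [G] test the first condition of membership, and the vectors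
    [2 (e_j A^T, e_j)] the second. *)
Lemma quatlat_dual v : quatlat v <-> forall w, quatlat w -> (4 %| ip v w)%Z.
Proof.
split=> [/quatlatP[p [t [s [-> tG]]]] w /quatlatP[p' [t' [s' [-> t'G]]]]|v_orth].
  by rewrite (ip_gen _ _ tG t'G) dvdz_mulr.
apply/andP; split; apply/forallP => j.
  rewrite ip_row; apply: v_orth; rewrite rowE -[_ *m G]addr0 -(scaler0 _ 2%:Z).
  by apply: (@quatlat_gen _ _ 0); rewrite mul0mx scaler0.
pose t := row_mx (delta_mx 0 j *m A^T) (delta_mx 0 j) : 'rV[int]_(r + c).
have /v_orth : quatlat (2%:Z *: t).
  rewrite -[_ *: t]add0r -(mul0mx _ G).
  apply: (@quatlat_gen _ _ (delta_mx 0 j *m A^T + delta_mx 0 j *m A^T *m F^T)).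
  rewrite mulGT; set a := delta_mx 0 j *m A^T; move: (a *m F^T) => b.
  by apply/rowP => i; rewrite !mxE; ring.
rewrite ipZr (@dvdz_mul2l 2 2) // -[v]hsubmxK ip_row_mx row_mxKl row_mxKr -ip_mulmx !ip_delta => h.
have -> : (rsubmx v - lsubmx v *m A) ord0 j =
    ((lsubmx v *m A) 0 j + rsubmx v 0 j) - 2%:Z * (lsubmx v *m A) 0 j.
  by rewrite mxE [X in _ + X]mxE; ring.
by rewrite rpredB ?dvdz_mulr.
Qed.

Lemma quatlat_even v : quatlat v -> (8 %| ip v v)%Z.
Proof.
case/quatlatP=> p [t [s [-> tG]]]; rewrite (ip_gen _ _ tG tG).
have /dvdzP[q ->] := dual_even tG.
rewrite mulmxDr ipDr -[ip p (p *m S^T)]ip_mulmx (ipC (p *m S)) (ipC s).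
by apply/dvdzP; exists (ip p (p *m S) + ip p s + q); ring.
Qed.

(** A nonzero residue word has weight at least 24, hence norm at least 24. Otherwise [v] is twice a
    vector of the dual binary code of even norm below 6, and the second bound makes this vector
    even. *)
Lemma quatlat_min v :
    (forall p, (0 < count id (bits p))%N -> (23 < count id (bits p) + count id (bits (p *m A)))%N) ->
    (forall f : 'rV[int]_c, (0 < count id (bits f) <= 4)%N ->
      (4 < count id (bits f) + count id (bits (f *m A^T)))%N) ->
  quatlat v -> ip v v < 24 -> exists y, v = 4%:Z *: y.
Proof.
move=> A_min AT_min /andP[/dvd_mxP[y vG] /dvd_mxP[z vz]] v_lt.
have vE : v = row_mx (lsubmx v) (lsubmx v *m A + 2%:Z *: z).
  by rewrite -vz addrC subrK hsubmxK.
have [p0|p_gt0] := posnP (count id (bits (lsubmx v))); last first.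
  have := A_min _ p_gt0; rewrite -(bits_eq (erefl (lsubmx v *m A + 2%:Z *: z))).
  move: v_lt; rewrite vE ip_row_mx !row_mxKl.
  by have := bits_norm (lsubmx v); have := bits_norm (lsubmx v *m A + 2%:Z *: z); lia.
have [p pE] := bits_even p0; pose f := p *m A + z.
have {}vE : v = 2%:Z *: row_mx p f by rewrite vE pE scale_row_mx scalerDr -scalemxAl.
have tG : row_mx p f *m G^T = 2%:Z *: y.
  by apply: (@scalemx_intI _ _ 2) => //; rewrite scalemxAl -vE vG scalerA.
have t_lt : ip (row_mx p f) (row_mx p f) < 6 by move: v_lt; rewrite vE ipZl ipZr; lia.
have t_le : ip (row_mx p f) (row_mx p f) <= 4 by have /dvdzP[q qE] := dual_even tG; lia.
have pE' : bits p = bits (f *m A^T).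
  apply: (@bits_eq _ _ _ (y - p *m F^T - f *m A^T)).
  move: tG; rewrite mulGT !scalerBr => <-; move: (p *m F^T) (f *m A^T) => X Y.
  by apply/rowP => i; rewrite !mxE; ring.
move: t_le; rewrite ip_row_mx => t_le.
have := bits_norm p; have := bits_norm f => f_le p_le.
have [f0|f_gt0] := posnP (count id (bits f)); last first.
  have := AT_min f; rewrite f_gt0 -pE'; lia.
have [f' f'E] := bits_even f0.
have [p' p'E] : exists p', p = 2%:Z *: p'.
  by apply: bits_even; rewrite pE' f'E -scalemxAl bits_double.
by exists (row_mx p' f'); rewrite vE p'E f'E -scale_row_mx scalerA.
Qed.

End QuaternaryLift.

(** * The case [k = 2]: the extended BCH code and its lift *)

Definition bch_rows : seq (seq bool) := Eval vm_compute in [seq [seq x == 1%N | x <- r] | r <-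
  [:: [:: 1; 1; 1; 1; 1; 0; 1; 0; 0; 1; 0; 0; 1; 0; 1; 1; 0; 0; 1; 0; 0; 1; 0; 0; 1; 0;
          0; 1; 0; 1; 1; 0; 0; 1; 0; 1; 0; 0; 0; 0; 0; 0; 1; 0; 0; 0; 1; 0; 1; 1; 1];
      [:: 1; 1; 1; 0; 0; 1; 0; 0; 1; 1; 1; 0; 1; 1; 1; 0; 0; 1; 0; 0; 0; 0; 1; 1; 0; 1;
          1; 1; 0; 1; 1; 0; 0; 0; 1; 1; 1; 1; 0; 1; 0; 1; 1; 1; 0; 1; 1; 1; 1; 1; 0];
      [:: 1; 1; 0; 1; 0; 0; 0; 1; 0; 0; 1; 0; 1; 1; 0; 1; 1; 1; 1; 0; 1; 0; 0; 0; 1; 1;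
          1; 0; 1; 1; 1; 0; 1; 0; 0; 0; 1; 1; 1; 0; 1; 0; 0; 1; 0; 1; 1; 1; 0; 0; 0];
      [:: 1; 1; 0; 0; 1; 0; 1; 0; 1; 1; 0; 1; 1; 1; 0; 1; 0; 0; 1; 0; 1; 0; 0; 0; 1; 0;
          0; 1; 0; 1; 1; 1; 0; 1; 1; 0; 1; 1; 1; 1; 0; 0; 0; 0; 1; 1; 1; 1; 0; 0; 0];
      [:: 1; 0; 1; 1; 0; 0; 1; 1; 1; 0; 1; 0; 0; 0; 1; 1; 0; 1; 0; 1; 1; 1; 0; 0; 0; 0;
          0; 0; 1; 1; 0; 1; 1; 1; 1; 0; 1; 0; 1; 0; 0; 1; 1; 0; 1; 0; 1; 1; 1; 0; 0];
      [:: 1; 0; 1; 0; 1; 0; 0; 0; 0; 1; 0; 1; 1; 1; 1; 1; 1; 0; 1; 0; 0; 1; 1; 0; 1; 1;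
          0; 1; 1; 0; 0; 1; 0; 0; 1; 1; 1; 0; 0; 1; 0; 0; 1; 1; 1; 0; 0; 1; 0; 0; 1];
      [:: 1; 0; 0; 1; 1; 1; 1; 0; 1; 0; 1; 0; 0; 1; 1; 0; 1; 0; 1; 0; 1; 1; 0; 1; 0; 1;
          0; 1; 0; 0; 1; 0; 1; 0; 1; 0; 0; 0; 0; 0; 0; 1; 1; 1; 1; 1; 1; 1; 1; 0; 0];
      [:: 0; 1; 1; 1; 0; 0; 0; 0; 1; 1; 1; 1; 1; 0; 0; 1; 1; 0; 0; 1; 1; 0; 1; 0; 1; 0;
          1; 0; 0; 1; 1; 1; 1; 0; 0; 1; 0; 1; 0; 0; 1; 0; 1; 1; 1; 0; 0; 1; 1; 0; 0];
      [:: 0; 1; 1; 0; 1; 0; 1; 1; 0; 0; 1; 1; 1; 0; 0; 1; 1; 0; 0; 1; 0; 1; 1; 1; 1; 0;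
          0; 1; 0; 0; 1; 0; 1; 1; 0; 0; 0; 0; 0; 1; 1; 1; 1; 0; 1; 0; 1; 1; 0; 1; 0];
      [:: 0; 1; 0; 1; 1; 1; 1; 0; 0; 1; 1; 0; 0; 1; 0; 1; 0; 1; 0; 1; 1; 0; 1; 1; 0; 1;
          0; 0; 1; 1; 0; 1; 0; 0; 1; 0; 0; 1; 1; 1; 1; 0; 0; 0; 0; 0; 0; 1; 1; 1; 1];
      [:: 0; 0; 1; 1; 1; 1; 0; 1; 1; 0; 1; 0; 1; 0; 1; 0; 1; 0; 1; 0; 0; 1; 1; 0; 0; 1;
          1; 0; 0; 1; 1; 1; 1; 0; 0; 1; 0; 0; 1; 0; 1; 1; 0; 0; 1; 1; 0; 0; 1; 1; 0];
      [:: 0; 0; 0; 0; 0; 1; 1; 1; 1; 1; 1; 1; 1; 1; 1; 1; 1; 1; 1; 1; 0; 0; 0; 0; 0; 0;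
          0; 0; 0; 0; 0; 0; 0; 0; 0; 1; 1; 1; 1; 1; 1; 1; 1; 1; 1; 1; 1; 1; 1; 1; 1];
      [:: 0; 0; 0; 0; 0; 0; 0; 0; 0; 0; 0; 0; 0; 0; 0; 0; 0; 0; 0; 0; 1; 1; 1; 1; 1; 1;
          1; 1; 1; 1; 1; 1; 1; 1; 1; 1; 1; 1; 1; 1; 1; 1; 1; 1; 1; 1; 1; 1; 1; 1; 1]]%N].
(** The matrix [F]: adding [2F] to the identity block makes the Gram matrix divisible by 4, with
    diagonal divisible by 8. *)
Definition lift_rows : seq (seq bool) := [seq [seq x == 1%N | x <- r] | r <-
  [:: [:: 0; 0; 0; 0; 0; 0; 0; 0; 0; 0; 0; 0; 0];
      [:: 1; 0; 0; 0; 0; 0; 1; 0; 0; 0; 0; 0; 0];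
      [:: 1; 0; 0; 0; 0; 0; 0; 0; 0; 0; 0; 0; 0];
      [:: 1; 0; 0; 0; 0; 0; 0; 0; 0; 0; 0; 0; 0];
      [:: 0; 1; 1; 1; 0; 0; 0; 0; 0; 0; 0; 0; 0];
      [:: 1; 0; 0; 0; 0; 0; 0; 0; 0; 0; 0; 0; 0];
      [:: 0; 0; 1; 1; 0; 1; 0; 0; 0; 0; 0; 0; 0];
      [:: 0; 0; 0; 1; 1; 1; 0; 0; 0; 0; 0; 0; 0];
      [:: 1; 1; 0; 1; 1; 1; 1; 0; 0; 0; 1; 0; 0];
      [:: 1; 0; 1; 1; 1; 0; 0; 1; 0; 0; 0; 0; 0];
      [:: 0; 0; 1; 1; 1; 0; 0; 0; 0; 0; 0; 0; 0];
      [:: 0; 0; 0; 0; 0; 0; 0; 0; 0; 0; 0; 0; 0];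
      [:: 0; 0; 0; 0; 0; 0; 0; 0; 0; 0; 0; 0; 0]]%N].

Definition bch_tr := Eval vm_compute in
  [seq [seq nth false row j | row <- bch_rows] | j <- iota 0 51].

Definition bit_entry (rows : seq (seq bool)) i j := int_of_bool (nth false (nth [::] rows i) j).
Definition unit_ent i j :=
  intZmod.addz (int_of_bool (i == j)) (intRing.mulz 2%Z (bit_entry lift_rows i j)).
Definition gram i j := intZmod.addz
  (nat_isum 13 (fun k => intRing.mulz (unit_ent i k) (unit_ent j k)))
  (nat_isum 51 (fun k => intRing.mulz (bit_entry bch_rows i k) (bit_entry bch_rows j k))).
Definition half_gram : seq (seq int) := Eval vm_compute in
  [seq [seq if (i < j)%N then (gram i j %/ 4)%Z else if i == j then (gram i j %/ 8)%Z else 0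
       | j <- iota 0 13] | i <- iota 0 13].

Lemma bch_gram : lift_gen (bit_mx 13 51 bch_rows) (bit_mx 13 13 lift_rows) *m
    (lift_gen (bit_mx 13 51 bch_rows) (bit_mx 13 13 lift_rows))^T =
  4%:Z *: ((\matrix_(i, j) get half_gram i j) + (\matrix_(i, j) get half_gram i j)^T).
Proof.
rewrite tr_row_mx mul_row_col; apply/matrixP => i j; rewrite !mxE.
have : all (fun i => all (fun j => gram i j == intRing.mulz 4%Z
    (intZmod.addz (get half_gram i j) (get half_gram j i))) (iota 0 13)) (iota 0 13).
  by vm_compute.
move/allP/(_ i); rewrite mem_iota ltn_ord => /(_ isT)/allP/(_ j); rewrite mem_iota ltn_ord => /(_ isT)/eqP gE.
transitivity (gram i j); last exact: gE.
rewrite /gram !nat_isumE; congr (_ + _); apply: eq_bigr => k _; rewrite !mxE //.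
by rewrite /unit_ent -!val_eqE; congr (_ * _); case: (_ == _).
Qed.

Lemma bch_ones : exists h, const_mx 1 *m bit_mx 13 51 bch_rows = const_mx 1 + 2%:Z *: h :> 'rV_51.
Proof.
have /dvd_mxP[h hE] : [forall j, (2%N %| ((const_mx 1 *m bit_mx 13 51 bch_rows : 'rV_51) - const_mx 1) ord0 j)%Z].
  apply/forallP => j.
  have : all (fun j => dvdn 2 (absz (intZmod.addz
      (nat_isum 13 (fun k => bit_entry bch_rows k j)) (-1)))) (iota 0 51).
    by vm_compute.
  move/allP/(_ j); rewrite mem_iota ltn_ord => /(_ isT).
  congr (dvdn _ (absz _)); rewrite !mxE nat_isumE; congr (_ + _).
  by apply: eq_bigr => k _; rewrite !mxE mul1r.
by exists h; rewrite -hE addrC subrK.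
Qed.

Lemma bit_mx_tr r c rows rows' :
    all (fun i => all (fun j => nth false (nth [::] rows i) j == nth false (nth [::] rows' j) i)
      (iota 0 c)) (iota 0 r) ->
  (bit_mx r c rows)^T = bit_mx c r rows'.
Proof.
move=> /allP h; apply/matrixP => j i; rewrite !mxE; congr int_of_bool.
have := h i; rewrite mem_iota ltn_ord => /(_ isT)/allP/(_ j).
by rewrite mem_iota ltn_ord => /(_ isT)/eqP.
Qed.

Lemma bch_min_weight (p : 'rV[int]_13) : (0 < count id (bits p))%N ->
  (23 < count id (bits p) + count id (bits (p *m bit_mx 13 51 bch_rows)))%N.
Proof.
move=> p_gt0; apply: (@min_weight_mulmx _ _ _ 13); last 1 first.
- by rewrite p_gt0 /=; have := count_size id (bits p); rewrite size_bits.
- by vm_compute.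
by vm_compute.
Qed.

Lemma bch_dual_weight (f : 'rV[int]_51) : (0 < count id (bits f) <= 4)%N ->
  (4 < count id (bits f) + count id (bits (f *m (bit_mx 13 51 bch_rows)^T)))%N.
Proof.
move=> f_wt; rewrite (@bit_mx_tr _ _ _ bch_tr); last by vm_compute.
by apply: min_weight_mulmx f_wt; vm_compute.
Qed.

(** The support of a word of weight 6 in the dual of the residue code; its double has norm
    [24 = 6 * 4]. *)
Definition dual_word := [:: 0; 1; 2; 5; 42; 44]%N.

Theorem extremal_2 : exists C : {set 'rV['Z_(2.*2)]_64}, extremal_typeII C.
Proof.
pose L : pred 'rV[int]_(13 + 51) := quatlat (bit_mx 13 51 bch_rows) (bit_mx 13 13 lift_rows).
have L_dual := quatlat_dual bch_gram.
apply: (@frame_code 2 4 L 4%:M) => //.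
- exact: (quatlat_even bch_gram bch_ones).
- move=> i; apply/L_dual => w _.
  by rewrite ipC -ip_row tr_scalar_mx mul_mx_scalar mxE dvdz_mulr.
- by rewrite tr_scalar_mx -scalar_mxM.
- move=> v Lv /(quatlat_min bch_ones bch_min_weight bch_dual_weight Lv)[y ->].
  by exists y; rewrite mul_mx_scalar.
pose t (j : nat) : int := int_of_bool (j \in dual_word).
exists (2%:Z *: row_mx (\row_(j < 13) t j) (\row_(j < 51) t (13 + j)%N)); split.
- apply/andP; split; apply/forallP => i.
    rewrite -scalemxAl mxE (@dvdz_mul2l 2 2) // tr_row_mx mul_row_col mxE.
    have : all (fun i => dvdn 2 (absz (intZmod.addz (nat_isum 13 (fun k => intRing.mulz (t k) (unit_ent i k)))
        (nat_isum 51 (fun k => intRing.mulz (t (13 + k)%N) (bit_entry bch_rows i k)))))) (iota 0 13).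
      by vm_compute.
    move/allP/(_ i); rewrite mem_iota ltn_ord => /(_ isT).
    congr (dvdn _ (absz _)); rewrite !mxE !nat_isumE; congr (_ + _); apply: eq_bigr => k _; rewrite !mxE //.
    by rewrite /unit_ent -!val_eqE; congr (_ * _); case: (_ == _).
  rewrite scale_row_mx row_mxKl row_mxKr -scalemxAl -scalerBr mxE dvdz_mulr //.
- rewrite ipZl ipZr (@ip_row_mx 13 51).
  have -> : (6 * 4)%N%:Z = 2%:Z * (2%:Z * (nat_isum 13 (fun k => intRing.mulz (t k) (t k)) +
      nat_isum 51 (fun k => intRing.mulz (t (13 + k)%N) (t (13 + k)%N)))) by vm_compute.
  by rewrite !nat_isumE; congr (_ * (_ * (_ + _))); apply: eq_bigr => k _; rewrite !mxE.
(* The first coordinate of the vector is 2, while the frame spans multiples of 4. *)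
move=> y /(congr1 (fun v : 'rV_(13 + 51) => v 0 (@lshift 13 51 ord0))).
rewrite scale_row_mx row_mxEl mul_mx_scalar !mxE.
by move: (y _ _) => z; rewrite /t /=; lia.
Qed.

Theorem theorem7p5 (k : nat) :
  (0 < k)%N -> exists C : {set 'rV['Z_(k.*2)]_64}, extremal_typeII C.
Proof.
case: k => [|[|[|k]]] // _; [exact: extremal_1 | exact: extremal_2 | exact: extremal_ge3].
Qed.
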